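(* Let $\mathcal{G}$ be a connected finite compact metric graph with vertex set $\mathsf V$ and edge set $\mathsf E$, and let $q=(q_{\mathsf e})_{\mathsf e\in\mathsf E}$ be a real-valued potential with $q_{\mathsf e}\in (C^\infty\cap L^\infty)(0,\ell_{\mathsf e})$ for every $\mathsf e\in\mathsf E$. Let $\beta,\beta'\in[0,\infty)$ be constants with $\beta+\beta'>0$ and such that $\beta=0$ or $\beta'=0$, and use them as constant coupling strengths, i.e. $\beta_{\mathsf v}=\beta$ and $\beta'_{\mathsf v}=\beta'$ for all $\mathsf v\in\mathsf V$. Let $\lambda_n^q(\beta)$, $\lambda_n^q(\beta')$, $\lambda_n^{q=0}(\beta')$ ($n\in\mathbb N$) denote the eigenvalues, in non-decreasing order and counted with multiplicity, of the self-adjoint Schrödinger operators $H^q_\beta$, $H^q_{\beta'}$, $H^{q=0}_{\beta'}$ (subject to $\delta'$-coupling conditions if the coupling strength is positive, and to anti-Kirchhoff conditions if it is $0$). Set $d_n(\beta,\beta'):=\lambda_n^q(\beta)-\lambda_n^q(\beta')$ and $d_n^q(\beta,\beta'):=\lambda_n^q(\beta)-\lambda_n^{q=0}(\beta')$. Then $$\lim_{N\to\infty}\frac1N\sum_{n=1}^N d_n(\beta,\beta')=\lim_{N\to\infty}\frac1N\sum_{n=1}^N d_n^q(\beta,\beta')=\begin{cases}+\infty, & \text{if }\beta=0,\\ -\infty, & \text{if }\beta'=0.\end{cases}$$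
   Context: Metric graph: $\mathcal G$ has finite edge set $\mathsf E$ and finite vertex set $\mathsf V$; each edge $\mathsf e$ is identified with an interval $(0,\ell_{\mathsf e})$, $0<\ell_{\mathsf e}<\infty$, whose two endpoints are attached to vertices. $L^2(\mathcal G)=\bigoplus_{\mathsf e}L^2(0,\ell_{\mathsf e})$, $\widetilde H^m(\mathcal G)=\bigoplus_{\mathsf e}H^m(0,\ell_{\mathsf e})$. Write $\mathsf e\sim\mathsf v$ if $\mathsf e$ is incident to $\mathsf v$ (sums over $\mathsf e\sim\mathsf v$ run over edge ends at $\mathsf v$, so a loop contributes twice). For $f=(f_{\mathsf e})_{\mathsf e}$, $f_{\mathsf e}(\mathsf v)$ is the boundary value of $f_{\mathsf e}$ at the endpoint of $\mathsf e$ attached to $\mathsf v$, and $f'_{\mathsf e}(\mathsf v)$ is the derivative at that endpoint taken in the direction from $\mathsf v$ into the edge. Operators: for $\beta=(\beta_{\mathsf v})_{\mathsf v}\in[0,\infty)^{|\mathsf V|}$, $H^q_\beta$ acts on $L^2(\mathcal G)$ by $(H^q_\beta f)_{\mathsf e}=-f''_{\mathsf e}+q_{\mathsf e}f_{\mathsf e}$ on the domain $\mathcal D_\beta$ of all $f\in\widetilde H^2(\mathcal G)$ such that at every vertex $\mathsf v$ the values $f'_{\mathsf e}(\mathsf v)$, $\mathsf e\sim\mathsf v$, coincide (common value $f'(\mathsf v)$) and $\sum_{\mathsf e\sim\mathsf v}f_{\mathsf e}(\mathsf v)=\beta_{\mathsf v}f'(\mathsf v)$. These are the $\delta'$-coupling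 conditions; for $\beta=0$ they are called anti-Kirchhoff conditions. If all $\beta_{\mathsf v}>0$, the quadratic form is $$h^q_\beta[f]=\int_{\mathcal G}(|f'|^2+q|f|^2)\,\mathrm dx+\sum_{\mathsf v\in\mathsf V}\frac1{\beta_{\mathsf v}}\Big|\sum_{\mathsf e\sim\mathsf v}f_{\mathsf e}(\mathsf v)\Big|^2$$ with form domain $\widetilde H^1(\mathcal G)$. For $\beta=0$ the quadratic form is $h^q_0[f]=\int_{\mathcal G}(|f'|^2+q|f|^2)\,\mathrm dx$ with form domain $\{f\in\widetilde H^1(\mathcal G):\sum_{\mathsf e\sim\mathsf v}f_{\mathsf e}(\mathsf v)=0\ \ \forall\,\mathsf v\in\mathsf V\}$. These operators are self-adjoint with purely discrete spectrum accumulating only at $+\infty$. $H^{q=0}_\beta$ is the operator with zero potential. *)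

(* Defs.v *)
From mathcomp Require Export all_boot all_order all_algebra.
From mathcomp Require Export complex.
From mathcomp Require Export all_classical all_reals all_analysis.
Export Order.TTheory GRing.Theory Num.Theory.
Export numFieldNormedType.Exports.

#[export] Set Implicit Arguments.
#[export] Unset Strict Implicit.
#[export] Unset Printing Implicit Defensive.

Global Open Scope classical_set_scope.
Global Open Scope complex_scope.
Global Open Scope ring_scope.

(* The edge e is the interval (0, elen e); its endpoint 0 is attached to
   [src e] and its endpoint [elen e] to [tgt e]. Loops and parallel edges are
   allowed; the orientation is only a parametrization. *)
Record metric_graph (R : realType) := MetricGraph {
  vertex : finType;
  edge : finType;
  src : edge -> vertex;
  tgt : edge -> vertex;
  elen : edge -> R;
  elen_gt0 : forall e, 0 < elen e }.

Definition adjacent (R : realType) (G : metric_graph R) : rel (vertex G) :=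
  fun u v => [exists e : edge G,
    ((src e == u) && (tgt e == v)) || ((src e == v) && (tgt e == u))].

Definition connected_graph (R : realType) (G : metric_graph R) : Prop :=
  forall u v : vertex G, connect (@adjacent R G) u v.

(* [(e, false)] is the end of e at 0, [(e, true)] the end at [elen e]; a loop
   at v therefore contributes two ends to v. *)
Definition edge_end (R : realType) (G : metric_graph R) : finType :=
  (edge G * bool)%type.

Definition end_vertex (R : realType) (G : metric_graph R)
    (p : edge_end G) : vertex G :=
  if p.2 then tgt p.1 else src p.1.

(* Functions on the graph. Elements of L^2 are considered up to
   [eq_L2] below; the values outside (0, elen e) carry no information, except
   that Sobolev functions are given by their continuous representative on
   [0, elen e]. *)
Definition gfun (R : realType) (G : metric_graph R) : Type :=
  edge G -> R -> R[i].

Definition eq_L2 (R : realType) (G : metric_graph R) (f g : gfun G) : Prop :=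
  forall e, f e = g e %[ae (@lebesgue_measure R) in `]0, elen e[%classic].

Definition is_L2 (R : realType) (l : R) (u : R -> R[i]) : Prop :=
  [/\ measurable_fun `]0, l[ (fun x => complex.Re (u x)),
      measurable_fun `]0, l[ (fun x => complex.Im (u x)) &
      (@lebesgue_measure R).-integrable `]0, l[
        (fun x => (complex.Re (u x) ^+ 2 + complex.Im (u x) ^+ 2)%:E)].

Definition Cintegral (R : realType) (A : set R) (u : R -> R[i]) : R[i] :=
  (\int[@lebesgue_measure R]_(x in A) complex.Re (u x)) +i*
  (\int[@lebesgue_measure R]_(x in A) complex.Im (u x)).

(* u is (the absolutely continuous representative on [0, l] of) an element of
   H^1(0, l), with derivative u' in L^2(0, l). *)
Definition H1_deriv (R : realType) (l : R) (u u' : R -> R[i]) : Prop :=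
  is_L2 l u' /\
  forall x, 0 <= x <= l -> u x = u 0 + Cintegral `]0, x[ u'.

(* f is in H^2 on every edge, with first and second derivatives f1 and f2. *)
Definition H2_deriv (R : realType) (G : metric_graph R)
    (f f1 f2 : gfun G) : Prop :=
  forall e, H1_deriv (elen e) (f e) (f1 e) /\ H1_deriv (elen e) (f1 e) (f2 e).

Definition end_value (R : realType) (G : metric_graph R) (f : gfun G)
    (p : edge_end G) : R[i] :=
  f p.1 (if p.2 then elen p.1 else 0).

(* Oriented from the vertex into the edge. *)
Definition end_deriv (R : realType) (G : metric_graph R) (f1 : gfun G)
    (p : edge_end G) : R[i] :=
  if p.2 then - f1 p.1 (elen p.1) else f1 p.1 0.

Definition delta_prime_conditions (R : realType) (G : metric_graph R)
    (beta : vertex G -> R) (f f1 : gfun G) : Prop :=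
  forall v : vertex G, exists d : R[i],
    (forall p : edge_end G, end_vertex p = v -> end_deriv f1 p = d) /\
    \sum_(p : edge_end G | end_vertex p == v) end_value f p = (beta v)%:C * d.

(* Graph of the operator H^q_beta: f is in its domain and H^q_beta f = g. *)
Definition schroedinger (R : realType) (G : metric_graph R)
    (q : edge G -> R -> R) (beta : vertex G -> R) (f g : gfun G) : Prop :=
  exists f1 f2 : gfun G,
    [/\ H2_deriv f f1 f2,
        delta_prime_conditions beta f f1 &
        eq_L2 g (fun e x => - f2 e x + (q e x)%:C * f e x)].

Definition eigenspace (R : realType) (G : metric_graph R)
    (q : edge G -> R -> R) (beta : vertex G -> R) (mu : R) : set (gfun G) :=
  [set f | schroedinger q beta f (fun e x => mu%:C * f e x)].

Definition lin_comb (R : realType) (G : metric_graph R) (k : nat)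
    (c : 'I_k -> R[i]) (F : 'I_k -> gfun G) : gfun G :=
  fun e x => \sum_(i < k) c i * F i e x.

(* The subspace W of L^2 has complex dimension k. *)
Definition has_dim (R : realType) (G : metric_graph R)
    (W : set (gfun G)) (k : nat) : Prop :=
  exists F : 'I_k -> gfun G,
    [/\ forall i, W (F i),
        forall c, eq_L2 (lin_comb c F) (fun _ _ => 0) -> forall i, c i = 0 &
        forall f, W f -> exists c, eq_L2 f (lin_comb c F)].

(* lam 0 <= lam 1 <= ... lists the eigenvalues of H^q_beta, each one as many
   times as its multiplicity; lam n is thus the (n+1)-st eigenvalue. *)
Definition eigenvalue_sequence (R : realType) (G : metric_graph R)
    (q : edge G -> R -> R) (beta : vertex G -> R) (lam : nat -> R) : Prop :=
  {homo lam : m n / (m <= n)%N >-> m <= n} /\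
  forall mu : R, exists2 k : nat,
    has_dim (eigenspace q beta mu) k & ([set n | lam n = mu] #= `I_k)%card.

Definition smooth_bounded_potential (R : realType) (G : metric_graph R)
    (q : edge G -> R -> R) : Prop :=
  forall e,
    (forall (n : nat) (x : R), 0 < x < elen e ->
       derivable (derive1n n (q e)) x 1) /\
    (exists M : R, \forall x \ae (@lebesgue_measure R),
       0 < x < elen e -> `|q e x| <= M).


Definition mean_diff (R : realType) (lam lam' : nat -> R) (N : nat) : R :=
  N%:R^-1 * \sum_(n < N) (lam n - lam' n).

(* Main.v *)
From HB Require Import structures.
Require Import Defs.
From mathcomp Require Import ring lra measurable_realfun.

(* The form b of the delta' operator B (beta > 0) lives on all of H^1, and the
   anti-Kirchhoff eigenfunctions lie in its domain, with vanishing vertex sums l.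
   Let g_0, g_1, ... be the eigenfunctions of B, with eigenvalues mu_k. If
   f_0, ..., f_(N-1) are orthonormal and l(f_n) = 0, then sum_n b[f_n] exceeds
   sum_(k<N) mu_k by a superlinear amount: otherwise the f_n would nearly span
   g_0, ..., g_(N-1), and l would nearly vanish there, but l is unbounded on L^2;
   the Sobolev bound l(f)^2 <= C (eps b[f] + |f|^2 / eps) makes this quantitative.
   The same bound for point evaluations gives the Weyl estimate mu_N >= c N^2.
   Enough eigenvalues of B are found by minimizing Rayleigh quotients, minimizing
   sequences being uniformly convergent along an ultrafilter. Bounded potentials
   only shift the means by O(1). *)

(** * Symmetric bilinear forms *)

(** Min-max alone gives only [sum mu_k <= sum b[f_n]]; the gain is hidden in the difference [Delta]
    of the two sides. Subtracting the level [mu N] everywhere writes [Delta] as three nonnegative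
    sums, so [Delta] controls at once how far the low [g k] are from the span of the [f n] and how
    much energy the [f n] have at high frequency. The representer [psi m] of [l] on the first [m]
    eigenvectors has squared norm [W m]. If [Delta] were small, [psi m] would lie nearly in the span
    of the [f n], yet be nearly orthogonal to each of them because [l (f n) = 0]. The outcome is
    [W m * sqrt (mu N) <= 24 * C * Delta], where [W m] is as large as desired and
    [sqrt (mu N) >= c * N]. For the [delta'] operator only [lam n <= mu n] is needed, so it suffices
    that enough eigenvalues exist; completeness of the [g k] never enters. Everything runs over the
    reals, on functions with bounded continuous derivatives, where the forms are integrals of
    continuous functions. That space is not closed under the limits taken in the minimization, hence
    a separate regularity argument for weak solutions. *)

Definition symform (R : realType) (V : lmodType R) (B : V -> V -> R) : Prop :=
  (forall a f g h, B (a *: f + g) h = a * B f h + B g h) /\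
  (forall f g, B f g = B g f).

Section symmetric_forms.
Context (R : realType) (V : lmodType R).
Implicit Types (B : V -> V -> R) (f g h : V).

Lemma symformDl B f g h : symform B -> B (f + g) h = B f h + B g h.
Proof. by move=> [+ _] => /(_ 1 f g h); rewrite scale1r mul1r. Qed.

Lemma symform0l B h : symform B -> B 0 h = 0.
Proof.
move=> sB; have := symformDl 0 0 h sB; rewrite addr0 => /eqP.
by rewrite -subr_eq subrr eq_sym => /eqP.
Qed.

Lemma symformZl B a f h : symform B -> B (a *: f) h = a * B f h.
Proof. by move=> sB; have [+ _] := sB; move=> /(_ a f 0 h); rewrite symform0l// !addr0. Qed.

Lemma symformZr B a f h : symform B -> B f (a *: h) = a * B f h.
Proof. by move=> sB; rewrite (sB.2 f) symformZl// (sB.2 h). Qed.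

Lemma symformDr B f g h : symform B -> B f (g + h) = B f g + B f h.
Proof. by move=> sB; rewrite (sB.2 f) symformDl// (sB.2 g) (sB.2 h). Qed.

Lemma symformBl B f g h : symform B -> B (f - g) h = B f h - B g h.
Proof. by move=> sB; rewrite symformDl// -scaleN1r symformZl// mulN1r. Qed.

Lemma symformBr B f g h : symform B -> B f (g - h) = B f g - B f h.
Proof. by move=> sB; rewrite (sB.2 f) symformBl// (sB.2 g) (sB.2 h). Qed.

Lemma symform_suml B (I : Type) (r : seq I) (P : pred I) (F : I -> V) h :
  symform B -> B (\sum_(i <- r | P i) F i) h = \sum_(i <- r | P i) B (F i) h.
Proof.
move=> sB; elim/big_rec2: _ => [|i y x _ <-]; first by rewrite symform0l.
by rewrite symformDl.
Qed.

Lemma symform_sumr B (I : Type) (r : seq I) (P : pred I) (F : I -> V) h :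
  symform B -> B h (\sum_(i <- r | P i) F i) = \sum_(i <- r | P i) B h (F i).
Proof.
by move=> sB; rewrite sB.2 symform_suml//; apply: eq_bigr => i _; rewrite sB.2.
Qed.

Lemma symform_sqrD B f g : symform B -> B (f + g) (f + g) = B f f + 2 * B f g + B g g.
Proof. by move=> sB; rewrite symformDl// !symformDr// (sB.2 g f); ring. Qed.

(** Positivity is asked only along the line [f + a *: g] and at [g], because the form [b - mu0 * ip]
    to which this is applied is nonnegative on an orthogonal complement only. *)
Lemma symform_CS_on B f g : symform B ->
  (forall a, 0 <= B (f + a *: g) (f + a *: g)) -> 0 <= B g g ->
  (B f g) ^+ 2 <= B f f * B g g.
Proof.
move=> sB B0 g0'.
have H t : 0 <= B f f + 2 * t * B f g + t ^+ 2 * B g g.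
  have := B0 t; rewrite symform_sqrD// !symformZr// symformZl//.
  by rewrite mulrA expr2 !mulrA.
have := g0'; rewrite le_eqVlt => /orP[/eqP g0|g0].
  have [->|d0] := eqVneq (B f g) 0; first by rewrite expr0n/= -g0 mulr0.
  (* With [B g g = 0] the quadratic is affine in [t]; this [t] makes it equal to [-1]. *)
  have := H (- (B f f + 1) / (2 * B f g)); rewrite -g0 mulr0 addr0.
  have -> : 2 * (- (B f f + 1) / (2 * B f g)) * B f g = - (B f f + 1) by field.
  lra.
have := H (- B f g / B g g).
have -> : B f f + 2 * (- B f g / B g g) * B f g + (- B f g / B g g) ^+ 2 * B g g
   = B f f - (B f g) ^+ 2 / B g g by field; rewrite gt_eqF.
by rewrite subr_ge0 ler_pdivrMr.
Qed.

Lemma symform_CS B f g : symform B -> (forall h, 0 <= B h h) ->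
  (B f g) ^+ 2 <= B f f * B g g.
Proof. by move=> sB B0; exact: symform_CS_on. Qed.

Definition orthonormal_family (B : V -> V -> R) (I : finType) (o : I -> V) : Prop :=
  forall i j, B (o i) (o j) = (i == j)%:R.

Definition ortho_residual (B : V -> V -> R) (I : finType) (o : I -> V) (f : V) : V :=
  f - \sum_i B (o i) f *: o i.

Section residual.
Context (B : V -> V -> R) (sB : symform B) (I : finType) (o : I -> V).
Hypothesis oo : orthonormal_family B o.

Lemma sum_orthonormal (c : I -> R) i : B (o i) (\sum_j c j *: o j) = c i.
Proof.
rewrite symform_sumr// (bigD1 i)//= symformZr// oo eqxx mulr1 big1 ?addr0// => j ji.
by rewrite symformZr// oo eq_sym (negbTE ji) mulr0.
Qed.

Lemma ortho_residual_orth f i : B (o i) (ortho_residual B o f) = 0.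
Proof. by rewrite symformBr// sum_orthonormal subrr. Qed.

(** The residual is [B]-orthogonal to each [o i], and [b (o i)] is a multiple of [B (o i)], so it is
    [b]-orthogonal too and no cross terms remain. The case [b = B] is Pythagoras. *)
Lemma eigenform_residual (b : V -> V -> R) (mu : I -> R) f : symform b ->
  (forall i h, b (o i) h = mu i * B (o i) h) ->
  b f f = \sum_i mu i * (B (o i) f) ^+ 2 +
          b (ortho_residual B o f) (ortho_residual B o f).
Proof.
move=> sb bmu; set r := ortho_residual B o f.
have fE : f = \sum_i B (o i) f *: o i + r by rewrite addrC subrK.
rewrite {1 2}fE symform_sqrD//.
have -> : b (\sum_i B (o i) f *: o i) r = 0.
  rewrite symform_suml// big1// => i _.
  by rewrite symformZl// bmu ortho_residual_orth !mulr0.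
rewrite mulr0 addr0; congr (_ + _).
rewrite symform_suml//; apply: eq_bigr => i _.
by rewrite symformZl// bmu sum_orthonormal; ring.
Qed.

Lemma sqr_residual f :
  B f f = \sum_i (B (o i) f) ^+ 2 + B (ortho_residual B o f) (ortho_residual B o f).
Proof.
rewrite (@eigenform_residual B (fun=> 1))// => [|i h]; last by rewrite mul1r.
by congr (_ + _); apply: eq_bigr => i _; rewrite mul1r.
Qed.

Lemma bessel f : (forall h, 0 <= B h h) -> \sum_i (B (o i) f) ^+ 2 <= B f f.
Proof. by move=> B0; rewrite [leRHS]sqr_residual lerDl. Qed.

End residual.

(** [B] is only semidefinite, so membership in the span is expressed by equality in Bessel's
    inequality, that is, by a residual of norm zero. [P] carries along a linear property, here that
    of being an eigenfunction. *)
Lemma gram_schmidt (B : V -> V -> R) (P : V -> Prop) (hs : seq V) :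
  symform B -> (forall h, 0 <= B h h) ->
  (forall a f g, P f -> P g -> P (a *: f + g)) -> P 0 ->
  (forall h, h \in hs -> P h) ->
  exists (r : nat) (o : 'I_r -> V),
    [/\ orthonormal_family B o, forall i, P (o i) &
        forall h, h \in hs -> B h h = \sum_i (B (o i) h) ^+ 2].
Proof.
move=> sB B0 PD P0; elim: hs => [_|x hs IH Phs].
  exists 0%N, (fun=> 0); split => //; first by case.
have IH1 : forall h, h \in hs -> P h by move=> h hh; apply: Phs; rewrite inE hh orbT.
have [r [+ [+ + +]]] := IH IH1 => o oo Po ho.
set y := ortho_residual B o x.
(* A vector with null residual adds nothing and is dropped, so [r] may be smaller than the length of
   the list. *)
have [y0|yn0] := eqVneq (B y y) 0.
  exists r, o; split=> // h; rewrite inE => /predU1P[->|/ho//].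
  by rewrite [LHS](sqr_residual sB oo) -/y y0 addr0.
have PB f g : P f -> P g -> P (f - g).
  by move=> Pf Pg; rewrite addrC -scaleN1r; apply: PD.
have PZ a f : P f -> P (a *: f) by move=> Pf; rewrite -[_ *: _]addr0; apply: PD.
have Py : P y.
  apply: PB; first by apply: Phs; rewrite inE eqxx.
  elim/big_ind: _ => //; last by move=> i _; exact: PZ.
  by move=> f g Pf Pg; rewrite -[f]scale1r; apply: PD.
have By : 0 < B y y by rewrite lt_def yn0 B0.
pose z := (Num.sqrt (B y y))^-1 *: y.
have zz : B z z = 1.
  rewrite symformZl// symformZr// mulrA -invfM -expr2 sqr_sqrtr ?B0// mulVf//.
have oz i : B (o i) z = 0 by rewrite symformZr// (ortho_residual_orth sB oo) mulr0.
pose o' (i : 'I_r.+1) := if unlift ord_max i is Some j then o j else z.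
have o'l j : o' (lift ord_max j) = o j by rewrite /o' liftK.
have o'm : o' ord_max = z by rewrite /o' unlift_none.
have oo' : orthonormal_family B o'.
  move=> i j; case: (unliftP ord_max i) => [i' ->|->];
    case: (unliftP ord_max j) => [j' ->|->].
  - by rewrite !o'l oo (inj_eq lift_inj).
  - by rewrite o'l o'm oz eq_sym (negbTE (neq_lift _ _)).
  - by rewrite o'l o'm sB.2 oz (negbTE (neq_lift _ _)).
  - by rewrite o'm zz eqxx.
exists r.+1, o'; split => //.
  move=> i; case: (unliftP ord_max i) => [i' ->|->]; first by rewrite o'l.
  by rewrite o'm; exact: PZ.
have E h : \sum_i (B (o' i) h) ^+ 2 = \sum_i (B (o i) h) ^+ 2 + (B z h) ^+ 2.
  rewrite big_ord_recr/= o'm; congr (_ + _); apply: eq_bigr => i _.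
  by rewrite -o'l; congr (B (o' _) _ ^+ 2); apply: val_inj; rewrite /= /bump leqNgt ltn_ord.
move=> h hin; apply/eqP; rewrite eq_le (bessel sB oo')// andbT E.
move: hin; rewrite inE => /predU1P[->|/ho ->]; last by rewrite lerDl sqr_ge0.
rewrite [leLHS](sqr_residual sB oo) lerD2l -/y.
have -> : B z x = Num.sqrt (B y y).
  rewrite symformZl//.
  have -> : B y x = B y y.
    apply/eqP; rewrite -subr_eq0 -symformBr// opprB subrKC symform_sumr//.
    rewrite big1// => i _.
    by rewrite symformZr// (sB.2 y) (ortho_residual_orth sB oo)// mulr0.
  by rewrite -[X in _ * X]sqr_sqrtr ?B0// expr2 mulKf// sqrtr_eq0 -ltNge.
by rewrite sqr_sqrtr.
Qed.

End symmetric_forms.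

Lemma left_kernel_vector (F : fieldType) (n m : nat) (A : 'M[F]_(n, m)) : (m < n)%N ->
  exists2 c : 'rV[F]_n, c != 0 & c *m A = 0.
Proof.
move=> mn; have : kermx A != 0.
  by rewrite -mxrank_eq0 mxrank_ker -lt0n subn_gt0 (leq_ltn_trans (rank_leq_col A)).
by move=> /rowV0Pn[c /sub_kermxP cA c0]; exists c.
Qed.

(** * Gap between eigenvalue sums *)

(** The last clause, minimality of each eigenvalue on the complement of the preceding eigenvectors,
    takes the place of completeness of [g]. *)
Definition min_eigensystem (R : realType) (V : lmodType R)
    (ip b : V -> V -> R) (mu : nat -> R) (g : nat -> V) : Prop :=
  [/\ {homo mu : m n / (m <= n)%N >-> m <= n},
      forall i j, ip (g i) (g j) = (i == j)%:R,
      forall k h, b (g k) h = mu k * ip (g k) h &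
      forall K f, (forall k, (k < K)%N -> ip (g k) f = 0) ->
        mu K * ip f f <= b f f].

Lemma sum_sqr_CS (R : realType) (I : finType) (a c : I -> R) :
  (\sum_i a i * c i) ^+ 2 <= (\sum_i (a i) ^+ 2) * (\sum_i (c i) ^+ 2).
Proof.
pose B (x y : {ffun I -> R^o}) : R := \sum_i x i * y i.
have sB : symform B.
  split=> [t f g h|f g]; last by apply: eq_bigr => i _; rewrite mulrC.
  rewrite /B mulr_sumr -big_split; apply: eq_bigr => i _ /=.
  by rewrite !ffunE /= mulrDl mulrA.
have B0 h : 0 <= B h h by apply: sumr_ge0 => i _; rewrite -expr2 sqr_ge0.
have := symform_CS [ffun i => a i] [ffun i => c i] sB B0.
rewrite /B; congr (_ ^+ 2 <= _ * _); apply: eq_bigr => i _; rewrite !ffunE//.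
Qed.

Section trace_gap.
Context (R : realType) (V : lmodType R) (ip b : V -> V -> R).
Hypotheses (sip : symform ip) (sb : symform b) (ip0 : forall f, 0 <= ip f f).
Context (mu : nat -> R) (g : nat -> V) (gsys : min_eigensystem ip b mu g).
(** A normalization achieved later by a shift of the form. It makes [(s k)^-1], with [s k] the
    square root of [mu k], an admissible [eps <= 1] in the Sobolev bound. *)
Hypothesis mu_ge1 : forall k, 1 <= mu k.

Let famg K : 'I_K -> V := fun k => g k.
Let res K f := ortho_residual ip (@famg K) f.
Let s k := Num.sqrt (mu k).

Let mono : {homo mu : m n / (m <= n)%N >-> m <= n}.
Proof. by case: gsys. Qed.

Let eig k h : b (g k) h = mu k * ip (g k) h.
Proof. by case: gsys. Qed.

Let famgo K : orthonormal_family ip (@famg K).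
Proof. by move=> i j; case: gsys => _ -> _ _. Qed.

Let mu_gt0 k : 0 < mu k.
Proof. by apply: lt_le_trans (mu_ge1 k). Qed.

Let s_ge1 k : 1 <= s k.
Proof. by rewrite -sqrtr1 ler_wsqrtr. Qed.

Let s_gt0 k : 0 < s k.
Proof. by apply: lt_le_trans (s_ge1 k). Qed.

Let s2 k : s k ^+ 2 = mu k.
Proof. by rewrite sqr_sqrtr// ltW. Qed.

Lemma form_residual K f : b f f = \sum_(k < K) mu k * (ip (g k) f) ^+ 2 +
   b (res K f) (res K f).
Proof.
rewrite (@eigenform_residual _ _ ip sip _ (@famg K) (@famgo K) b (fun k => mu k))//.
by move=> i h; rewrite eig.
Qed.

Lemma norm_residual K f : ip f f = \sum_(k < K) (ip (g k) f) ^+ 2 +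
   ip (res K f) (res K f).
Proof. exact: sqr_residual. Qed.

Lemma residual_gap K f : mu K * ip (res K f) (res K f) <= b (res K f) (res K f).
Proof.
case: gsys => _ _ _; apply=> k kK.
exact: (ortho_residual_orth sip (@famgo K) f (Ordinal kK)).
Qed.

(** * Size of a functional on the low eigenvectors *)

Section functional.
Context (l : V -> R) (C : R).
Hypothesis (C0 : 0 < C).
Hypothesis (lin : forall a f h, l (a *: f + h) = a * l f + l h).
Hypothesis (sobolev : forall eps f, 0 < eps -> eps <= 1 ->
  (l f) ^+ 2 <= C * (eps * b f f + eps^-1 * ip f f)).

Let l0 : l 0 = 0.
Proof.
have := lin 1 0 0; rewrite scale1r addr0 mul1r => /eqP.
by rewrite -subr_eq subrr eq_sym => /eqP.
Qed.

Let lsum (I : finType) (c : I -> R) (F : I -> V) :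
  l (\sum_i c i *: F i) = \sum_i c i * l (F i).
Proof.
elim/big_rec2: _ => [//|i y x _ <-]; exact: lin.
Qed.

(** The squared norm of [l] on the span of the first [K] eigenvectors; [psi K] below is the vector
    representing [l] there. *)
Definition boundary_mass K := \sum_(k < K) (l (g k)) ^+ 2.

Let W := boundary_mass.

Let W_ge0 K : 0 <= W K.
Proof. by apply: sumr_ge0 => k _; exact: sqr_ge0. Qed.

Let psi K := \sum_(k < K) l (g k) *: g k.

Let ip_psi K : ip (psi K) (psi K) = W K.
Proof.
rewrite /psi symform_suml//; apply: eq_bigr => k _.
by rewrite symformZl// (@sum_orthonormal _ _ ip sip _ _ (@famgo K) (fun k => l (g k)))// expr2.
Qed.

(** The Sobolev bound is applied to [psi K.+1] itself, where [l] and [ip] both give [W K.+1] and [b]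
    is at most [mu K * W K.+1]. The choice [eps = (s K)^-1] balances the two terms, and one factor
    [W K.+1] cancels. *)
Lemma boundary_mass_le K : W K.+1 <= 2 * C * s K.
Proof.
have lpsi : l (psi K.+1) = W K.+1.
  by rewrite /psi lsum; apply: eq_bigr => k _; rewrite expr2.
have bpsi : b (psi K.+1) (psi K.+1) <= mu K * W K.+1.
  rewrite {1}/psi symform_suml// mulr_sumr; apply: ler_sum => k _.
  rewrite symformZl// eig (@sum_orthonormal _ _ ip sip _ _ (@famgo K.+1) (fun k => l (g k)))//.
  rewrite mulrCA -expr2 ler_wpM2r ?sqr_ge0// mono//.
  by rewrite -ltnS.
have := @sobolev (s K)^-1 (psi K.+1); rewrite invr_gt0 invf_le1// => /(_ (s_gt0 K) (s_ge1 K)).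
rewrite lpsi ip_psi invrK => H.
have {H} : W K.+1 ^+ 2 <= 2 * C * s K * W K.+1.
  apply: (le_trans H).
  rewrite -[2 * C]mulrC -!mulrA ler_pM2l//.
  have -> : 2 * (s K * W K.+1) = (s K)^-1 * (mu K * W K.+1) + s K * W K.+1.
    by rewrite -s2; field; rewrite gt_eqF.
  by rewrite lerD2r ler_pM2l// invr_gt0.
have := W_ge0 K.+1; rewrite le_eqVlt => /predU1P[<- _|W0].
  by rewrite !mulr_ge0// ltW.
by rewrite expr2 ler_pM2r.
Qed.

(** At the scale [eps = (s K)^-1] the spectral gap of the residual bounds the norm term by the
    energy term, whence the factor 2. *)
Lemma functional_residual K f :
  (l (res K f)) ^+ 2 <= 2 * C * b (res K f) (res K f) / s K.
Proof.
have := @sobolev (s K)^-1 (res K f); rewrite invr_gt0 invf_le1// => /(_ (s_gt0 K) (s_ge1 K)).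
move=> /le_trans; apply; rewrite invrK -[2 * C]mulrC -!mulrA ler_pM2l//.
set r := res K f.
have H : s K * ip r r <= b r r / s K.
  by rewrite ler_pdivlMr// mulrAC -expr2 s2; exact: residual_gap.
by rewrite [_^-1 * _]mulrC; lra.
Qed.

Let l_split K f : l f = \sum_(k < K) ip (g k) f * l (g k) + l (res K f).
Proof.
have := lin 1 (\sum_(k < K) ip (g k) f *: g k) (res K f).
by rewrite scale1r mul1r lsum => <-; rewrite addrC /res /ortho_residual subrK.
Qed.

Let l_split_sqr K f x : W K <= x ->
  (l f) ^+ 2 <= 2 * x * ip f f + 4 * C * b f f / s K.
Proof.
move=> Wx; rewrite (l_split K f).
set u := \sum_(k < K) _; set v := l _.
have hu : u ^+ 2 <= x * ip f f.
  apply: le_trans (sum_sqr_CS _ _) _; rewrite mulrC; apply: ler_pM.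
  - by apply: sumr_ge0 => i _; exact: sqr_ge0.
  - by apply: sumr_ge0 => i _; exact: sqr_ge0.
  - exact: Wx.
  - exact: (bessel sip (@famgo K) f ip0).
have hv : v ^+ 2 <= 2 * C * b f f / s K.
  apply: (le_trans (functional_residual K f)); rewrite ler_pM2r ?invr_gt0//.
  rewrite ler_pM2l ?mulr_gt0// [leRHS](form_residual K) lerDr sumr_ge0// => k _.
  by rewrite mulr_ge0 ?sqr_ge0// ltW.
have -> : 4 * C * b f f / s K = 2 * (2 * C * b f f / s K) by ring.
have : 0 <= (u - v) ^+ 2 by exact: sqr_ge0.
rewrite !expr2 in hu hv *; lra.
Qed.

Hypothesis l_unbounded : forall x, exists f, x * ip f f < (l f) ^+ 2.
Context (c : R) (c0 : 0 < c) (weyl : forall N, c * N%:R <= s N).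

(** If [W] stayed below [x], then splitting [f] at index [m] and letting [m] grow would remove the
    energy term, since [s m] tends to infinity, and leave [(l f) ^+ 2 <= 2 * x * ip f f] for every
    [f]. *)
Lemma boundary_mass_unbounded x : exists m, x < W m.
Proof.
apply: contrapT => /forallNP H.
(* The factor 2 is the one in [(u + v)^2 <= 2 u^2 + 2 v^2], used in [l_split_sqr]. *)
have [f hf] := l_unbounded (2 * x).
have bf0 : 0 <= b f f.
  have := residual_gap 0 f; rewrite /res /ortho_residual big_ord0 subr0.
  by apply: le_trans; rewrite mulr_ge0// ltW.
set d := (l f) ^+ 2 - 2 * x * ip f f.
have d0 : 0 < d by rewrite subr_gt0.
have [m] : exists m, 4 * C * b f f / (c * d) < m%:R.
  exists (Num.trunc (4 * C * b f f / (c * d))).+1.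
  by rewrite truncnS_gt.
rewrite ltr_pdivrMr ?mulr_gt0// => hm.
have := @l_split_sqr m f x; rewrite leNgt; have /negP := H m => /negbTE ->.
move=> /(_ isT); rewrite -lerBlDl -/d ler_pdivlMr// leNgt => /negP; apply.
rewrite (lt_le_trans hm)// mulrA mulrC ler_pM2l// mulrC; exact: weyl.
Qed.

(** * Excess of the form over the eigenvalue sum *)

Section trace.
Context (N : nat) (f : 'I_N -> V).
Hypotheses (fo : orthonormal_family ip f) (lf : forall n, l (f n) = 0).

(** [rho k] is the squared norm of the projection of [g k] onto the span of the [f n], so
    [1 - rho k] is the squared distance of [g k] from that span. *)
Let Delta := \sum_n b (f n) (f n) - \sum_(k < N) mu k.
Let rho k := \sum_n (ip (f n) (g k)) ^+ 2.

Let rho_le1 k : rho k <= 1.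
Proof.
rewrite (le_trans (bessel sip fo (g k) ip0))//.
by case: gsys => _ -> _ _; rewrite eqxx.
Qed.

(** The [f n] have total mass [N], and there are [N] eigenvalues in the subtracted sum, so [mu N]
    may be subtracted from both without changing [Delta]. Each of the three sums that result is
    nonnegative by monotonicity of [mu], so each is at most [Delta]. *)
Let DeltaE K : (N <= K)%N ->
  Delta = \sum_(k < N) (mu N - mu k) * (1 - rho k) +
          \sum_(N <= k < K) (mu k - mu N) * rho k +
          \sum_n (b (res K (f n)) (res K (f n)) - mu N * ip (res K (f n)) (res K (f n))).
Proof.
move=> NK.
have E1 : \sum_n b (f n) (f n) = \sum_(k < K) mu k * rho k + \sum_n b (res K (f n)) (res K (f n)).
  rewrite (eq_bigr _ (fun n _ => form_residual K (f n))) big_split/=; congr (_ + _).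
  rewrite exchange_big/=; apply: eq_bigr => k _; rewrite mulr_sumr.
  by apply: eq_bigr => n _; rewrite sip.2.
have E2 : N%:R = \sum_(k < K) rho k + \sum_n ip (res K (f n)) (res K (f n)).
  have <- : \sum_n ip (f n) (f n) = N%:R.
    by rewrite (eq_bigr (fun=> 1)) ?sumr_const ?card_ord// => n _; rewrite fo eqxx.
  rewrite (eq_bigr _ (fun n _ => norm_residual K (f n))) big_split/=; congr (_ + _).
  rewrite exchange_big/=; apply: eq_bigr => k _.
  by apply: eq_bigr => n _; rewrite sip.2.
have split (F : nat -> R) : \sum_(k < K) F k = \sum_(k < N) F k + \sum_(N <= k < K) F k.
  by rewrite -!(big_mkord xpredT F) (big_cat_nat (n := N)).
rewrite /Delta E1 (split (fun k => mu k * rho k)) sumrB -mulr_sumr.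
have -> : \sum_n ip (res K (f n)) (res K (f n)) =
    N%:R - \sum_(k < N) rho k - \sum_(N <= k < K) rho k.
  rewrite E2 (split rho); ring.
have -> : \sum_(k < N) (mu N - mu k) * (1 - rho k) =
   mu N * N%:R - mu N * \sum_(k < N) rho k - \sum_(k < N) mu k + \sum_(k < N) mu k * rho k.
  have -> : mu N * N%:R = \sum_(k < N) mu N by rewrite sumr_const card_ord mulr_natr.
  rewrite mulr_sumr -!sumrB -big_split; apply: eq_bigr => k _ /=; ring.
have -> : \sum_(N <= k < K) (mu k - mu N) * rho k =
   \sum_(N <= k < K) mu k * rho k - mu N * \sum_(N <= k < K) rho k.
  by rewrite mulr_sumr -sumrB; apply: eq_bigr => k _ /=; ring.
ring.
Qed.

Let summand_res K n : (N <= K)%N ->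
  0 <= b (res K (f n)) (res K (f n)) - mu N * ip (res K (f n)) (res K (f n)).
Proof.
move=> NK; rewrite subr_ge0 (le_trans _ (residual_gap K (f n)))//.
by rewrite ler_wpM2r// mono.
Qed.

Let sum_head_le K m : (m <= N)%N -> (N <= K)%N ->
  (mu N - mu m) * \sum_(k < m) (1 - rho k) <= Delta.
Proof.
move=> mN NK; rewrite (DeltaE NK) -addrA; apply: ler_wpDr.
  apply: addr_ge0; last by apply: sumr_ge0 => n _; exact: summand_res.
  rewrite big_seq; apply: sumr_ge0 => k; rewrite mem_index_iota => /andP[Nk _].
  apply: mulr_ge0; first by rewrite subr_ge0 mono.
  by apply: sumr_ge0 => n _; exact: sqr_ge0.
have H k : (k < N)%N -> 0 <= (mu N - mu k) * (1 - rho k).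
  by move=> kN; rewrite mulr_ge0// subr_ge0 ?rho_le1// mono// ltnW.
rewrite -(big_mkord xpredT (fun k => (mu N - mu k) * (1 - rho k))).
rewrite (big_cat_nat (n := m))//= ler_wpDr//.
  rewrite big_seq; apply: sumr_ge0 => k; rewrite mem_index_iota => /andP[_]; exact: H.
rewrite big_mkord mulr_sumr; apply: ler_sum => k _.
by rewrite ler_wpM2r ?subr_ge0// lerD2l lerN2 mono// ltnW.
Qed.

Let sum_tail_le K : (N <= K)%N ->
  \sum_n (b (res K (f n)) (res K (f n)) - mu N * ip (res K (f n)) (res K (f n))) <= Delta.
Proof.
move=> NK; rewrite (DeltaE NK) lerDr addr_ge0//.
  by apply: sumr_ge0 => k _; rewrite mulr_ge0// subr_ge0 ?rho_le1// mono// ltnW.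
rewrite big_seq; apply: sumr_ge0 => k; rewrite mem_index_iota => /andP[Nk _].
apply: mulr_ge0; first by rewrite subr_ge0 mono.
by apply: sumr_ge0 => n _; exact: sqr_ge0.
Qed.

(** Two cutoffs are in play: [m], well below [N], selects the vector [psi m] to be captured, and
    [K], where [mu] has about doubled, separates the high frequencies of the [f n]. *)
Lemma trace_gap m : 2 * mu m <= mu N -> W m * s N <= 24 * C * Delta.
Proof.
move=> mN2.
have mN : (m <= N)%N.
  rewrite leqNgt; apply/negP => /ltnW /mono; have := mu_gt0 m; lra.
have [K0 hK0] : exists K, 2 * mu N <= mu K.
  exists (Num.trunc (2 * mu N / c)).+1.
  have h : 2 * mu N / c < (Num.trunc (2 * mu N / c)).+1%:R by rewrite truncnS_gt.
  rewrite -[leRHS]s2; apply: (@le_trans _ _ (s (Num.trunc (2 * mu N / c)).+1)).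
    apply: le_trans _ (weyl _); rewrite [leRHS]mulrC -ler_pdivrMr//; exact: ltW.
  by rewrite expr2 ler_peMl// ltW.
(* The first index with [mu >= 2 * mu N], written [K.+1] below. Being above the level leaves half of
   the tail energy after subtracting [mu N]; being the first, [mu K < 2 * mu N], which keeps
   [W K.+1] of order [s N]. *)
have [K] := ex_minnP (ex_intro (fun K => 2 * mu N <= mu K) K0 hK0) => hK Kmin.
have NK : (N < K)%N.
  rewrite ltnNge; apply/negP => /mono; have := mu_gt0 N; lra.
case: K hK Kmin NK => // K hK Kmin NK.
have hK' : mu K < 2 * mu N.
  by rewrite ltNge; apply/negP => /Kmin; rewrite ltnn.
have NK' := ltnW NK.
have De0 : 0 <= Delta.
  by apply: le_trans _ (sum_tail_le NK'); apply: sumr_ge0 => n _; exact: summand_res.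
have sKle : s K <= 2 * s N.
  rewrite -(@ler_pXn2r _ 2)// ?nnegrE ?mulr_ge0 ?ltW//.
  by rewrite exprMn !s2; have := mu_gt0 N; have := ltW hK'; lra.
have WK : W K.+1 <= 4 * C * s N.
  apply: le_trans (boundary_mass_le K) _.
  have -> : 4 * C * s N = 2 * C * (2 * s N) by ring.
  by rewrite ler_pM2l ?mulr_gt0.
(* Since [l (f n) = 0], the part of [l (f n)] seen below the cutoff must cancel the part above it,
   which is small. *)
have fpsi n : ip (f n) (psi K.+1) = - l (res K.+1 (f n)).
  apply/eqP; rewrite -addr_eq0 -[X in _ == X](lf n) (l_split K.+1 (f n)); apply/eqP.
  congr (_ + _); rewrite /psi symform_sumr//; apply: eq_bigr => k _.
  by rewrite symformZr// mulrC sip.2.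
have sumpsi : \sum_n (ip (f n) (psi K.+1)) ^+ 2 <= 4 * C * Delta / s N.
  have : \sum_n (ip (f n) (psi K.+1)) ^+ 2 <= \sum_n (4 * C / s N) *
     (b (res K.+1 (f n)) (res K.+1 (f n)) - mu N * ip (res K.+1 (f n)) (res K.+1 (f n))).
    apply: ler_sum => n _; rewrite fpsi sqrrN.
    apply: le_trans (functional_residual K.+1 (f n)) _.
    set r := res _ _.
    have h1 : mu K.+1 * ip r r <= b r r by exact: residual_gap.
    have h2 : 2 * mu N * ip r r <= mu K.+1 * ip r r by rewrite ler_wpM2r.
    have br : 0 <= b r r.
      by apply: le_trans _ h1; rewrite mulr_ge0// ltW.
    have h3 : b r r / 2 <= b r r - mu N * ip r r by lra.
    have h4 : 2 * C * b r r / s K.+1 <= 2 * C * b r r / s N.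
      rewrite ler_wpM2l ?mulr_ge0// ?(ltW C0)// lef_pV2 ?posrE// ler_sqrt ?mono// ltW//.
    apply: le_trans h4 _.
    have -> : 2 * C * b r r / s N = 4 * C / s N * (b r r / 2) by field; rewrite gt_eqF.
    by rewrite ler_pM2l// divr_gt0// mulr_gt0.
  move=> /le_trans; apply; rewrite -mulr_sumr.
  have -> : 4 * C * Delta / s N = 4 * C / s N * Delta by ring.
  rewrite ler_pM2l ?sum_tail_le//.
  by rewrite divr_gt0// mulr_gt0.
have Psi_psi : ip (psi K.+1) (psi m) = W m.
  rewrite [X in ip _ X]/psi symform_sumr//; apply: eq_bigr => k _.
  rewrite symformZr// expr2; congr (_ * _); rewrite sip.2.
  have kK : (k < K.+1)%N by apply: leq_trans NK'; apply: leq_trans mN.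
  exact: (@sum_orthonormal _ _ ip sip _ _ (@famgo K.+1) (fun k => l (g k)) (Ordinal kK)).
pose u := \sum_n ip (f n) (psi m) * ip (f n) (psi K.+1).
pose v := \sum_(k < m) l (g k) * ip (psi K.+1) (ortho_residual ip f (g k)).
(* [W m = <psi, Psi>] split along the span of the [f n]: inside it [l (f n) = 0]
   makes [<f n, psi>] small, outside it the [1 - rho k] are small. *)
have Wuv : W m = u + v.
  rewrite /v /u -Psi_psi [X in ip _ X]/psi symform_sumr//.
  rewrite (eq_bigr (fun k : 'I_m => l (g k) * ip (psi K.+1) (g k))); last first.
    by move=> k _; rewrite symformZr.
  rewrite -[LHS]addr0 -[X in _ + X](subrr u) -/u addrCA; congr (_ + _).
  rewrite /u.
  have -> : \sum_n ip (f n) (psi m) * ip (f n) (psi K.+1) =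
     \sum_(k < m) l (g k) * \sum_n (ip (f n) (g k) * ip (f n) (psi K.+1)).
    under [RHS]eq_bigr do rewrite mulr_sumr.
    rewrite exchange_big/=; apply: eq_bigr => n _.
    rewrite {1}/psi symform_sumr// mulr_suml; apply: eq_bigr => k _.
    by rewrite symformZr// mulrA.
  rewrite -sumrB; apply: eq_bigr => k _; rewrite -mulrBr; congr (_ * _).
  rewrite symformBr//; congr (_ - _); rewrite symform_sumr//.
  by apply: eq_bigr => n _; rewrite symformZr// (sip.2 (f n) (psi _)).
have hu : u ^+ 2 <= W m * (4 * C * Delta / s N).
  apply: le_trans (sum_sqr_CS _ _) _; apply: ler_pM => //.
  - by apply: sumr_ge0 => n _; exact: sqr_ge0.
  - by apply: sumr_ge0 => n _; exact: sqr_ge0.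
  - rewrite -ip_psi; exact: (bessel sip fo _ ip0).
(* Here [8 = 4 * 2]: the bound [4 * C * s N] for [W K.+1] times [2 * Delta / mu N] for the sum of
   the [1 - rho k]. *)
have hv : v ^+ 2 <= W m * (8 * C * Delta / s N).
  apply: le_trans (sum_sqr_CS _ _) _; apply: ler_wpM2l; first exact: W_ge0.
  have : \sum_(k < m) ip (psi K.+1) (ortho_residual ip f (g k)) ^+ 2 <=
     \sum_(k < m) W K.+1 * (1 - rho k).
    apply: ler_sum => k _; rewrite -ip_psi.
    apply: le_trans (symform_CS _ _ sip ip0) _.
    have := sqr_residual sip fo (g k); case: (gsys) => _ -> _ _; rewrite eqxx => H.
    suff -> : ip (ortho_residual ip f (g k)) (ortho_residual ip f (g k)) = 1 - rho k by [].
    by apply/eqP; rewrite eq_sym subr_eq addrC; apply/eqP.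
  move=> /le_trans; apply; rewrite -mulr_sumr.
  have h1 := sum_head_le mN NK'.
  set S := \sum_(k < m) (1 - rho k) in h1 *.
  have S0 : 0 <= S by apply: sumr_ge0 => k _; rewrite subr_ge0 rho_le1.
  apply: (@le_trans _ _ (4 * C * s N * S)); first by rewrite ler_wpM2r.
  (* The hypothesis [2 * mu m <= mu N] leaves a gap of at least [mu N / 2] above the first [m]
     eigenvalues. *)
  have h2 : mu N / 2 * S <= Delta.
    by apply: le_trans _ h1; rewrite ler_wpM2r//; have := mu_gt0 m; lra.
  have -> : 4 * C * s N * S = 8 * C * (mu N / 2 * S) / s N.
    by rewrite -s2; field; rewrite gt_eqF.
  by rewrite ler_pM2r ?invr_gt0// ler_pM2l// mulr_gt0.
(* From [(u + v)^2 <= 2 u^2 + 2 v^2], with [24 = 2 * (4 + 8)]. *)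
have {}H : W m ^+ 2 <= W m * (24 * C * Delta / s N).
  have -> : W m * (24 * C * Delta / s N) =
     2 * (W m * (4 * C * Delta / s N)) + 2 * (W m * (8 * C * Delta / s N)) by ring.
  rewrite {1}Wuv; have : 0 <= (u - v) ^+ 2 by exact: sqr_ge0.
  rewrite !expr2 in hu hv *; lra.
rewrite -ler_pdivlMr//.
have := W_ge0 m; rewrite le_eqVlt => /predU1P[<-|W0].
  by rewrite !mulr_ge0// ?invr_ge0 ltW.
by rewrite expr2 ler_pM2l in H.
Qed.

End trace.

(** Fix [m] with [W m] above [24 * C * |x| / c]. All [N] with [c * N > 2 * mu m] then qualify,
    because [mu N >= s N >= c * N], and the factor [s N] in [trace_gap] supplies the growth linear
    in [N]. *)
Lemma trace_gap_superlinear x : exists N0, forall N (f : 'I_N -> V), (N0 <= N)%N ->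
  orthonormal_family ip f -> (forall n, l (f n) = 0) ->
  \sum_(k < N) mu k + x * N%:R <= \sum_n b (f n) (f n).
Proof.
have [m hm] := boundary_mass_unbounded (24 * C * `|x| / c).
exists (Num.trunc (2 * mu m / c)).+1 => N f hN fo lf.
have hN' : 2 * mu m < c * N%:R.
  rewrite [ltRHS]mulrC -ltr_pdivrMr//.
  apply: (@lt_le_trans _ _ (Num.trunc (2 * mu m / c)).+1%:R).
    by rewrite truncnS_gt.
  by rewrite ler_nat.
have mN : 2 * mu m <= mu N.
  rewrite -[leRHS]s2; apply: le_trans (ltW hN') _.
  by apply: le_trans (weyl N) _; rewrite expr2 ler_peMl// ltW.
have := trace_gap fo lf mN.
set D := _ - _ => H; rewrite -lerBrDl -/D.
have H1 : 24 * C * `|x| / c * (c * N%:R) <= 24 * C * D.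
  apply: le_trans _ H; apply: ler_pM => //; last by apply: ltW.
  - by rewrite !mulr_ge0// ?invr_ge0// ltW.
  - by rewrite mulr_ge0// ltW.
rewrite mulrA divfK ?gt_eqF// -mulrA ler_pM2l ?mulr_gt0// in H1.
apply: le_trans _ H1; by rewrite ler_wpM2r// ler_norm.
Qed.

End functional.
End trace_gap.

(** * Calculus on an interval *)

Section interval.
Context (R : realType) (l : R) (l0 : 0 < l).
Implicit Types (f g h F : R -> R) (x y a : R).
Notation mu := (@lebesgue_measure R).

(** The class of integrands. Potentials are smooth inside an edge and bounded, but may have no limit
    at its ends; this class contains them and is stable under sums and products. *)
Definition bcont (g : R -> R) : Prop :=
  (forall x, 0 < x < l -> {for x, continuous g}) /\
  (exists M, forall x, 0 < x < l -> `|g x| <= M).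

Definition Int (g : R -> R) : R := \int[mu]_(x in `]0, l[) g x.

(** Nothing is asked of [g] at the ends, where the two-sided derivative of [f] would depend on
    values outside the interval. *)
Definition has_deriv (f g : R -> R) : Prop :=
  {within `[0, l], continuous f} /\ (forall x, 0 < x < l -> is_derive x 1 f (g x)).

Lemma near_open x : 0 < x < l -> \forall y \near x, 0 < y < l.
Proof.
move=> xl; have : x \in `]0, l[ by rewrite in_itv.
by move=> /near_in_itvoo; apply: filterS => y; rewrite in_itv.
Qed.

Lemma continuous_at_eq g h x : 0 < x < l -> (forall x, 0 < x < l -> g x = h x) ->
  {for x, continuous g} -> {for x, continuous h}.
Proof.
move=> xl gh; rewrite /prop_for /continuous_at -gh// => cg.
apply: cvg_trans cg; apply: near_eq_cvg.
by near=> y; rewrite gh//; near: y; exact: near_open.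
Unshelve. all: by end_near. Qed.

Lemma bcont_eq g h : (forall x, 0 < x < l -> g x = h x) -> bcont g -> bcont h.
Proof.
move=> gh [cg [M gM]]; split.
  by move=> x xl; apply: continuous_at_eq gh (cg _ xl).
by exists M => x xl; rewrite -gh// gM.
Qed.

Lemma bcont_cst a : bcont (fun=> a).
Proof. by split=> [x _|]; [exact: cst_continuous|exists `|a|]. Qed.

Lemma bcontD g h : bcont g -> bcont h -> bcont (fun x => g x + h x).
Proof.
move=> [cg [M gM]] [ch [M' hM]]; split.
  by move=> x xl; apply: (@continuousD R R^o); [exact: cg|exact: ch].
exists (M + M') => x xl; apply: le_trans (ler_normD _ _) _.
by rewrite lerD ?gM ?hM.
Qed.

Lemma bcontM g h : bcont g -> bcont h -> bcont (fun x => g x * h x).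
Proof.
move=> [cg [M gM]] [ch [M' hM]]; split.
  by move=> x xl; apply: continuousM; [exact: cg|exact: ch].
by exists (M * M') => x xl; rewrite normrM ler_pM ?gM ?hM.
Qed.

Lemma bcontZ a h : bcont h -> bcont (fun x => a * h x).
Proof. by apply: bcontM; exact: bcont_cst. Qed.

Lemma bcontN h : bcont h -> bcont (fun x => - h x).
Proof. by move=> /(bcontZ (-1)); apply: bcont_eq => x _; rewrite mulN1r. Qed.

Lemma bcontB g h : bcont g -> bcont h -> bcont (fun x => g x - h x).
Proof. by move=> bg bh; apply: bcontD bg (bcontN bh). Qed.

Lemma bcont_measurable g : bcont g -> measurable_fun `]0, l[ g.
Proof.
move=> [cg _]; apply: open_continuous_measurable_fun; first exact: interval_open.
by move=> x; rewrite inE/= in_itv/= => /cg.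
Qed.

Lemma bcont_integrable g : bcont g -> mu.-integrable `]0, l[ (EFin \o g).
Proof.
move=> bg; apply: measurable_bounded_integrable => //.
- have : (mu (`]0, l[%classic)%R < +oo)%E.
    by rewrite lebesgue_measure_itv/= lte_fin l0 oppr0 adde0 ltry.
  exact.
- exact: bcont_measurable.
- case: bg => _ [M gM]; exists M; split; first exact: num_real.
  move=> z Mz x; rewrite /= in_itv/= => /gM/le_trans; apply; exact: ltW.
Qed.

Lemma eq_Int g h : (forall x, 0 < x < l -> g x = h x) -> Int g = Int h.
Proof. by move=> gh; apply: eq_Rintegral => x; rewrite inE/= in_itv/= => /gh. Qed.

Lemma IntD g h : bcont g -> bcont h -> Int (fun x => g x + h x) = Int g + Int h.
Proof. by move=> bg bh; apply: RintegralD => //; exact: bcont_integrable. Qed.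

Lemma IntZ a g : bcont g -> Int (fun x => a * g x) = a * Int g.
Proof. by move=> bg; apply: RintegralZl => //; exact: bcont_integrable. Qed.

Lemma IntN g : bcont g -> Int (fun x => - g x) = - Int g.
Proof. by move=> bg; rewrite -mulN1r -IntZ//; apply: eq_Int => x _; rewrite mulN1r. Qed.

Lemma IntB g h : bcont g -> bcont h -> Int (fun x => g x - h x) = Int g - Int h.
Proof. by move=> bg bh; rewrite IntD// ?IntN//; exact: bcontN. Qed.

Lemma Int_ge0 g : (forall x, 0 < x < l -> 0 <= g x) -> 0 <= Int g.
Proof. by move=> g0; apply: Rintegral_ge0 => x /=; rewrite in_itv => /g0. Qed.

Lemma Int_le g h : bcont g -> bcont h -> (forall x, 0 < x < l -> g x <= h x) ->
  Int g <= Int h.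
Proof.
move=> bg bh gh; rewrite -subr_ge0 -IntB//; apply: Int_ge0 => x xl.
by rewrite subr_ge0 gh.
Qed.

Lemma Int_cst a : Int (fun=> a) = a * l.
Proof.
rewrite /Int Rintegral_cst//; congr (_ * _).
have E : mu `]0, l[%classic = l%:E by rewrite lebesgue_measure_itv/= lte_fin l0 oppr0 adde0.
exact: (congr1 fine E).
Qed.

Lemma has_deriv_der f g x : has_deriv f g -> 0 < x < l -> derive1 f x = g x.
Proof. by move=> [_ df] /df H; rewrite derive1E; exact: derive_val. Qed.

Lemma has_deriv_eq f g h : (forall x, 0 < x < l -> g x = h x) ->
  has_deriv f g -> has_deriv f h.
Proof. by move=> gh [cf df]; split=> // x xl; rewrite -gh//; exact: df. Qed.

Lemma has_deriv_cst a : has_deriv (fun=> a) (fun=> 0).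
Proof.
split=> [|x _]; first by move=> x; exact: cst_continuous.
exact: is_derive_cst.
Qed.

Lemma has_derivD f f1 g g1 : has_deriv f f1 -> has_deriv g g1 ->
  has_deriv (fun x => f x + g x) (fun x => f1 x + g1 x).
Proof.
move=> [cf df] [cg dg]; split; first exact: within_continuousD.
by move=> x xl; apply: (@is_deriveD _ _ _ f g); [exact: df|exact: dg].
Qed.

Lemma has_derivM f f1 g g1 : has_deriv f f1 -> has_deriv g g1 ->
  has_deriv (fun x => f x * g x) (fun x => f1 x * g x + f x * g1 x).
Proof.
move=> [cf df] [cg dg]; split.
  by move=> x; apply: continuousM; [exact: cf|exact: cg].
move=> x xl.
have -> : f1 x * g x + f x * g1 x = f x *: g1 x + g x *: f1 x.
  by rewrite addrC [X in _ + X]mulrC.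
by apply: (@is_deriveM _ _ f g); [exact: df|exact: dg].
Qed.

Lemma has_derivZ a f f1 : has_deriv f f1 ->
  has_deriv (fun x => a * f x) (fun x => a * f1 x).
Proof.
move=> df; apply: has_deriv_eq (has_derivM (has_deriv_cst a) df) => x _.
by rewrite mul0r add0r.
Qed.

Lemma has_derivB f f1 g g1 : has_deriv f f1 -> has_deriv g g1 ->
  has_deriv (fun x => f x - g x) (fun x => f1 x - g1 x).
Proof.
move=> df dg; have := has_derivD df (has_derivZ (-1) dg).
by under eq_fun do rewrite mulN1r; under [X in has_deriv _ X]eq_fun do rewrite mulN1r.
Qed.

Lemma has_deriv_id : has_deriv id (fun=> 1).
Proof.
split=> [|x _]; first by apply: continuous_subspaceT => x; exact: cvg_id.
exact: is_derive_id.
Qed.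

Lemma has_deriv_ndecr f g : has_deriv f g -> (forall x, 0 < x < l -> 0 <= g x) ->
  forall x y, 0 <= x -> x <= y -> y <= l -> f x <= f y.
Proof.
move=> [cf df] g0 x y x0 xy yl.
apply: (@ger0_derive1_le_cc R f 0 l) => //.
- by move=> z; rewrite in_itv/= => /df [].
- by move=> z; rewrite in_itv/= => zl; rewrite (has_deriv_der (conj cf df) zl) g0.
- by rewrite in_itv/= x0 (le_trans xy).
- by rewrite in_itv/= (le_trans x0).
Qed.

Lemma has_deriv_uniq f g h : has_deriv f h -> has_deriv g h ->
  forall x, 0 <= x <= l -> f x - f 0 = g x - g 0.
Proof.
move=> df dg x /andP[x0 xl]; have d := has_derivB df dg.
have d' := has_derivB dg df.
have h1 := has_deriv_ndecr d _ (lexx 0) x0 xl.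
have h2 := has_deriv_ndecr d' _ (lexx 0) x0 xl.
have {}h1 : f 0 - g 0 <= f x - g x by apply: h1 => z _; rewrite subrr.
have {}h2 : g 0 - f 0 <= g x - f x by apply: h2 => z _; rewrite subrr.
lra.
Qed.

Lemma within_bounded f : {within `[0, l], continuous f} ->
  exists M, forall x, 0 <= x <= l -> `|f x| <= M.
Proof.
move=> cf; have [c _ hc] := EVT_max (ltW l0) cf; have [d _ hd] := EVT_min (ltW l0) cf.
exists (`|f c| + `|f d|) => x xl.
have {}hc := hc x; have {}hd := hd x; rewrite in_itv/= xl in hc hd.
have {}hc := hc isT; have {}hd := hd isT.
rewrite ler_norml; apply/andP; split.
  have := ler_norm (- f d); rewrite normrN; have := normr_ge0 (f c); lra.
have := ler_norm (f c); have := normr_ge0 (f d); lra.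
Qed.

Lemma within_bcont f : {within `[0, l], continuous f} -> bcont f.
Proof.
move=> cf; split.
  by move=> x xl; apply: (within_continuous_continuous l0 cf); rewrite in_itv.
have [M fM] := within_bounded cf; exists M => x /andP[x0 xl].
by apply: fM; rewrite !ltW.
Qed.

Lemma has_deriv_bcont f g : has_deriv f g -> bcont f.
Proof. by move=> [/within_bcont]. Qed.

(** The integrand is cut off outside the open interval, so the values of [g] at the ends and beyond
    are irrelevant. *)
Definition prim (g : R -> R) (x : R) : R :=
  \int[mu]_(t in `[0, x]) (g \_ `]0, l[) t.

Let patch_int g : mu.-integrable `]0, l[ (EFin \o g) ->
  mu.-integrable `[0, l] (EFin \o (g \_ `]0, l[)).
Proof.
rewrite integrable_mkcond//= -restrict_EFin => h.
exact: integrableS h.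
Qed.

Lemma prim_continuous g : mu.-integrable `]0, l[ (EFin \o g) ->
  {within `[0, l], continuous (prim g)}.
Proof.
by move=> ig; exact: parameterized_integral_continuous (ltW l0) (patch_int ig).
Qed.

Lemma prim_has_deriv g : bcont g -> has_deriv (prim g) g.
Proof.
move=> bg; have ig := bcont_integrable bg; split; first exact: prim_continuous.
move=> x xl; have /andP[x0 xl'] := xl.
have cg : {for x, continuous (g \_ `]0, l[)}.
  apply: (@continuous_at_eq g) => //; last by case: bg => + _; exact.
  by move=> y yl; rewrite patchE mem_set//= in_itv.
have [dF F'] := continuous_FTC1_closed xl' (patch_int ig) x0 cg.
have -> : g x = derive1 (prim g) x.
  by rewrite F' patchE mem_set//= in_itv.
by rewrite derive1E; apply/derivableP.
Qed.

Lemma prim_integral g x : mu.-integrable `]0, l[ (EFin \o g) -> 0 <= x <= l ->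
  prim g x = \int[mu]_(t in `]0, x[) g t.
Proof.
move=> ig /andP[x0 xl].
have i1 : mu.-integrable `[0, x] (EFin \o (g \_ `]0, l[)).
  apply: integrableS (patch_int ig) => //; exact: subset_itvl.
rewrite /prim -Rintegral_itv_bndo_bndc; last first.
  by apply: integrableS i1 => //; exact: subset_itv_co_cc.
rewrite -Rintegral_itv_obnd_cbnd; last first.
  by apply: integrableS i1 => //; exact: subset_itv_oo_cc.
apply: eq_Rintegral => y; rewrite inE/= in_itv/= => /andP[y0 yx].
by rewrite patchE mem_set//= in_itv/= y0 (lt_le_trans yx).
Qed.

Lemma primE g x : bcont g -> 0 <= x <= l -> prim g x = \int[mu]_(t in `]0, x[) g t.
Proof. by move=> bg; exact: prim_integral (bcont_integrable bg). Qed.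

Lemma has_deriv_eqf f h g : (forall x, 0 <= x <= l -> f x = h x) ->
  has_deriv f g -> has_deriv h g.
Proof.
move=> fh [cf df]; split.
  apply: subspace_eq_continuous cf => x; rewrite inE/= in_itv/=; exact: fh.
move=> x xl; apply: near_eq_is_derive (df x xl).
near=> y; have /andP[y0 yl] : 0 < y < l by near: y; exact: near_open.
by rewrite fh// !ltW.
Unshelve. all: by end_near. Qed.

Lemma prim0 g : prim g 0 = 0.
Proof. by rewrite /prim set_itv1 Rintegral_set1. Qed.

Lemma prim_l g : bcont g -> prim g l = Int g.
Proof. by move=> bg; rewrite primE// lexx ltW. Qed.

Lemma FTC_x f g x : bcont g -> has_deriv f g -> 0 <= x <= l ->
  f x = f 0 + \int[mu]_(t in `]0, x[) g t.
Proof.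
move=> bg dfg xl; rewrite -primE//.
by have := has_deriv_uniq dfg (prim_has_deriv bg) xl; rewrite prim0; lra.
Qed.

Lemma FTC f g : bcont g -> has_deriv f g -> Int g = f l - f 0.
Proof.
move=> bg dfg; have := FTC_x bg dfg (x := l); rewrite lexx ltW// => /(_ isT) ->.
by rewrite /Int; ring.
Qed.

(** The primitive of [g] is nondecreasing and vanishes at both ends, so it is zero, and so is its
    derivative. *)
Lemma Int_eq0 g : bcont g -> (forall x, 0 < x < l -> 0 <= g x) -> Int g = 0 ->
  forall x, 0 < x < l -> g x = 0.
Proof.
move=> bg g0 Ig0 x xl; have dF := prim_has_deriv bg.
have F0 y : 0 < y < l -> prim g y = 0.
  move=> /andP[/ltW y0 /ltW yl]; apply/eqP; rewrite eq_le.
  apply/andP; split.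
    by rewrite -Ig0 -(prim_l bg) (has_deriv_ndecr dF g0).
  by rewrite -(prim0 g) (has_deriv_ndecr dF g0).
rewrite -(has_deriv_der dF xl) derive1E.
transitivity ('D_1 (cst 0 : R -> R) x); last by rewrite derive_cst.
apply: near_eq_derive; near=> y; rewrite F0//.
by near: y; exact: near_open.
Unshelve. all: by end_near. Qed.

(** Both [prim p - f] and [prim p + f] are nondecreasing. *)
Lemma deriv_dominated f f1 p x y : has_deriv f f1 -> bcont p ->
  (forall x, 0 < x < l -> `|f1 x| <= p x) -> 0 <= x -> x <= y -> y <= l ->
  `|f y - f x| <= prim p y - prim p x.
Proof.
move=> df bp f1p x0 xy yl; have dp := prim_has_deriv bp.
have h1 : prim p x - f x <= prim p y - f y.
  apply: (has_deriv_ndecr (has_derivB dp df)) => // z /f1p; rewrite ler_norml; lra.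
have h2 : prim p x + f x <= prim p y + f y.
  apply: (has_deriv_ndecr (has_derivD dp df)) => // z /f1p; rewrite ler_norml; lra.
by rewrite ler_norml; apply/andP; split; lra.
Qed.

Lemma deriv_dominated_Int f f1 p x y : has_deriv f f1 -> bcont p ->
  (forall x, 0 < x < l -> `|f1 x| <= p x) -> 0 <= x <= l -> 0 <= y <= l ->
  `|f y - f x| <= Int p.
Proof.
move=> df bp f1p.
have dp := prim_has_deriv bp.
have p0 z : 0 < z < l -> 0 <= p z by move=> /f1p; apply: le_trans.
wlog xy : x y / x <= y.
  move=> H xl yl; have [/H|/ltW/H] := leP x y; first exact.
  by rewrite distrC; apply.
move=> /andP[x0 xl] /andP[y0 yl].
apply: le_trans (deriv_dominated df bp f1p x0 xy yl) _.
have := has_deriv_ndecr dp p0 (lexx 0) x0 xl.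
have := has_deriv_ndecr dp p0 y0 yl (lexx _).
rewrite prim0 prim_l//; lra.
Qed.

(** The derivative of [f ^+ 2] is dominated by [eps * f1 ^+ 2 + eps^-1 * f ^+ 2], so [f x ^+ 2]
    exceeds [f t ^+ 2] by at most the integral of that. Averaging over [t] in the interval produces
    the term with [l^-1]. *)
Lemma sobolev f f1 x eps : has_deriv f f1 -> bcont f1 -> 0 < eps -> 0 <= x <= l ->
  (f x) ^+ 2 <= eps * Int (fun t => f1 t ^+ 2) + (eps^-1 + l^-1) * Int (fun t => f t ^+ 2).
Proof.
move=> df bf1 e0 xl.
have bf := has_deriv_bcont df.
have sq h : bcont h -> bcont (fun t => h t ^+ 2) by move=> bh; exact: bcontM.
pose p t := eps * f1 t ^+ 2 + eps^-1 * f t ^+ 2.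
have bp : bcont p by apply: bcontD; apply: bcontZ; exact: sq.
have dff := has_derivM df df.
have dom t : 0 < t < l -> `|f1 t * f t + f t * f1 t| <= p t.
  move=> _; rewrite /p.
  have : 0 <= (f1 t - eps^-1 * f t) ^+ 2 by exact: sqr_ge0.
  have : 0 <= (f1 t + eps^-1 * f t) ^+ 2 by exact: sqr_ge0.
  have E (s : R) : (f1 t + s * eps^-1 * f t) ^+ 2 * eps =
      eps * f1 t ^+ 2 + s ^+ 2 * eps^-1 * f t ^+ 2 + 2 * s * f1 t * f t.
    by field; rewrite gt_eqF.
  rewrite -(pmulr_lge0 _ e0) => h1; rewrite -(pmulr_lge0 _ e0) => h2.
  have := E 1; have := E (-1); rewrite mulN1r mul1r mulNr; rewrite sqrrN expr1n => h3 h4.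
  rewrite ler_norml; apply/andP; split; lra.
have Ip : Int p = eps * Int (fun t => f1 t ^+ 2) + eps^-1 * Int (fun t => f t ^+ 2).
  rewrite IntD ?IntZ//; by [apply: sq|apply: bcontZ; exact: sq].
have H t : 0 < t < l -> f x ^+ 2 - Int p <= f t ^+ 2.
  move=> /andP[/ltW t0 /ltW tl].
  have := deriv_dominated_Int dff bp dom (x := t) (y := x).
  rewrite t0 tl => /(_ isT xl); rewrite ler_norml !expr2 => /andP[_]; lra.
have := Int_le (bcont_cst (f x ^+ 2 - Int p)) (sq _ bf) H.
rewrite Int_cst -ler_pdivlMr// Ip [_ / l]mulrC; lra.
Qed.

(** A form of Hölder continuity of exponent one half that is linear in the energy: it integrates
    [|f1| <= eps * f1 ^+ 2 + eps^-1], and [eps] is left free. *)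
Lemma equicontinuity f f1 x y eps : has_deriv f f1 -> bcont f1 -> 0 < eps ->
  0 <= x <= l -> 0 <= y <= l ->
  `|f y - f x| <= eps * Int (fun t => f1 t ^+ 2) + eps^-1 * `|y - x|.
Proof.
move=> df bf1 e0.
have bsq : bcont (fun t => f1 t ^+ 2) by exact: bcontM.
have [cp dp] := prim_has_deriv bsq.
wlog xy : x y / x <= y.
  move=> H xl yl; have [/H|/ltW/H] := leP x y; first exact.
  by rewrite distrC [`|y - x|]distrC; apply.
move=> /andP[x0 xl] /andP[y0 yl].
pose p t := eps * f1 t ^+ 2 + eps^-1.
have bp : bcont p by apply: bcontD (bcont_cst _); exact: bcontZ.
have dom t : 0 < t < l -> `|f1 t| <= p t.
  move=> _; rewrite /p -(ler_pM2r e0) mulrDl mulVf ?gt_eqF//.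
  rewrite -{1}(gtr0_norm e0) -normrM.
  have : 0 <= (`|f1 t * eps| - 1) ^+ 2 by exact: sqr_ge0.
  have -> : eps * f1 t ^+ 2 * eps = `|f1 t * eps| ^+ 2.
    by rewrite real_normK ?num_real//; ring.
  have := normr_ge0 (f1 t * eps); rewrite !expr2; lra.
apply: le_trans (deriv_dominated df bp dom x0 xy yl) _.
pose q t := eps * prim (fun t => f1 t ^+ 2) t + eps^-1 * t.
have dq : has_deriv q p.
  apply: has_deriv_eq (has_derivD (has_derivZ eps (conj cp dp)) (has_derivZ eps^-1 has_deriv_id)).
  by move=> t _; rewrite mulr1.
have h1 := has_deriv_uniq dq (prim_has_deriv bp) (x := x).
have h2 := has_deriv_uniq dq (prim_has_deriv bp) (x := y).
have {}h1 := h1 _; have {}h2 := h2 _; rewrite x0 xl y0 yl in h1 h2.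
have {}h1 := h1 isT; have {}h2 := h2 isT.
have -> : prim p y - prim p x = q y - q x by lra.
rewrite /q ger0_norm ?subr_ge0//.
have nn z : 0 < z < l -> 0 <= f1 z ^+ 2 by move=> _; exact: sqr_ge0.
have := has_deriv_ndecr (conj cp dp) nn (lexx 0) x0 xl.
have := has_deriv_ndecr (conj cp dp) nn y0 yl (lexx _).
rewrite prim0 prim_l// => k1 k2.
have : eps * (prim (fun t => f1 t ^+ 2) y - prim (fun t => f1 t ^+ 2) x) <=
    eps * Int (fun t => f1 t ^+ 2).
  by rewrite ler_pM2l//; lra.
lra.
Qed.

End interval.

(** * Function space and forms on a metric graph *)

Section graph_space.
Context (R : realType) (G : metric_graph R).
Implicit Types (q : edge G -> R -> R).

Let len_gt0 (e : edge G) : 0 < elen e. Proof. exact: elen_gt0. Qed.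

(** Smaller than the form domain, but it contains every eigenfunction, since a bounded continuous
    potential gives a bounded continuous second derivative. *)
Definition regular (f : edge G -> R -> R) : Prop :=
  forall e, exists2 g, has_deriv (elen e) (f e) g & bcont (elen e) g.

Definition regular_pred : {pred edge G -> R -> R} := fun f => `[< regular f >].

Lemma regular_submod : submod_closed regular_pred.
Proof.
split.
  by apply/asboolP => e; exists (fun=> 0); [exact: has_deriv_cst|exact: bcont_cst].
move=> a f g /asboolP rf /asboolP rg; apply/asboolP => e.
have [f1 df bf1] := rf e; have [g1 dg bg1] := rg e.
exists (fun x => a * f1 x + g1 x).
  exact: (has_derivD (has_derivZ a df) dg).
exact: bcontD (bcontZ a bf1) bg1.
Qed.

HB.instance Definition _ := GRing.isSubmodClosed.Build _ _ regular_pred regular_submod.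

(** Elements are functions on the whole line and their equality takes all values into account, so
    [ip] is only semidefinite; a null vector vanishes inside the edges ([ip_eq0]). *)
Record gspace := GSpace { gval :> edge G -> R -> R; gvalP : gval \in regular_pred }.
HB.instance Definition _ := [isSub for gval].
HB.instance Definition _ := [Choice of gspace by <:].
HB.instance Definition _ := [SubChoice_isSubLmodule of gspace by <:].

Arguments gval : simpl never.
Implicit Types (f g h u : gspace).

Lemma gspaceE a f g e x : (a *: f + g : gspace) e x = a * f e x + g e x.
Proof. by []. Qed.

Lemma gspace_der f e : has_deriv (elen e) (f e) (derive1 (f e)).
Proof.
have /asboolP/(_ e)[g dg _] := gvalP f.
by apply: has_deriv_eq (dg) => x xl; rewrite (has_deriv_der dg).
Qed.

Lemma gspace_bcont f e : bcont (elen e) (f e).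
Proof. exact: has_deriv_bcont (gspace_der f e). Qed.

Lemma gspace_bcont1 f e : bcont (elen e) (derive1 (f e)).
Proof.
have /asboolP/(_ e)[g dg bg] := gvalP f.
by apply: bcont_eq bg => x xl; rewrite (has_deriv_der dg).
Qed.

Lemma gspace_der_lin a f g e x : 0 < x < elen e ->
  derive1 ((a *: f + g : gspace) e) x = a * derive1 (f e) x + derive1 (g e) x.
Proof.
move=> xl.
exact: (has_deriv_der (has_derivD (has_derivZ a (gspace_der f e)) (gspace_der g e)) xl).
Qed.

Definition end_val (f : edge G -> R -> R) (p : edge_end G) : R :=
  f p.1 (if p.2 then elen p.1 else 0).

Definition end_slope (f1 : edge G -> R -> R) (p : edge_end G) : R :=
  if p.2 then - f1 p.1 (elen p.1) else f1 p.1 0.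

Definition vertex_sum (v : vertex G) (f : edge G -> R -> R) : R :=
  \sum_(p : edge_end G | end_vertex p == v) end_val f p.

Definition ip f g : R := \sum_e Int (elen e) (fun x => f e x * g e x).

Definition energy q f g : R :=
  \sum_e Int (elen e) (fun x => derive1 (f e) x * derive1 (g e) x + q e x * (f e x * g e x)).

Definition vertex_form f g : R := \sum_v vertex_sum v f * vertex_sum v g.

Definition bounded_potential q := forall e, bcont (elen e) (q e).

Lemma symform_ip : symform ip.
Proof.
split=> [a f g h|f g]; last first.
  by apply: eq_bigr => e _; apply: eq_Int => x _; rewrite mulrC.
rewrite /ip mulr_sumr -big_split; apply: eq_bigr => e _ /=.
have bc (u w : gspace) : bcont (elen e) (fun x => u e x * w e x).
  by apply: bcontM; exact: gspace_bcont.
rewrite -IntZ// -IntD//; last exact: bcontZ.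
by apply: eq_Int => x _; rewrite gspaceE; ring.
Qed.

Lemma ip_ge0 f : 0 <= ip f f.
Proof. by apply: sumr_ge0 => e _; apply: Int_ge0 => x _; rewrite -expr2 sqr_ge0. Qed.

Lemma energy_bcont q f g e : bounded_potential q ->
  bcont (elen e) (fun x => derive1 (f e) x * derive1 (g e) x + q e x * (f e x * g e x)).
Proof.
move=> bq; apply: bcontD; first by apply: bcontM; exact: gspace_bcont1.
apply: bcontM; first exact: bq.
by apply: bcontM; exact: gspace_bcont.
Qed.

Lemma symform_energy q : bounded_potential q -> symform (energy q).
Proof.
move=> bq; split=> [a f g h|f g]; last first.
  by apply: eq_bigr => e _; apply: eq_Int => x _; ring.
rewrite /energy mulr_sumr -big_split; apply: eq_bigr => e _ /=.
rewrite -IntZ//; last exact: energy_bcont.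
rewrite -IntD//; last first.
- exact: energy_bcont.
- by apply: bcontZ; exact: energy_bcont.
by apply: eq_Int => x xl; rewrite gspaceE gspace_der_lin//; ring.
Qed.

Lemma vertex_sum_lin v a f g :
  vertex_sum v (a *: f + g : gspace) = a * vertex_sum v f + vertex_sum v g.
Proof. by rewrite /vertex_sum mulr_sumr -big_split; apply: eq_bigr. Qed.

Lemma symform_vertex : symform vertex_form.
Proof.
split=> [a f g h|f g]; last by apply: eq_bigr => v _; rewrite mulrC.
rewrite /vertex_form mulr_sumr -big_split; apply: eq_bigr => v _ /=.
by rewrite vertex_sum_lin; ring.
Qed.

Lemma vertex_form_ge0 f : 0 <= vertex_form f f.
Proof. by apply: sumr_ge0 => v _; rewrite -expr2 sqr_ge0. Qed.

Lemma symform_comb (c : R) (B1 B2 : gspace -> gspace -> R) :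
  symform B1 -> symform B2 -> symform (fun f g => B1 f g + c * B2 f g).
Proof.
move=> s1 s2; split=> [a f g h|f g]; last by rewrite s1.2 s2.2.
by rewrite s1.1 s2.1; ring.
Qed.

(** Regrouping by edge ends instead of vertices; a loop is counted at both of its ends. *)
Lemma vertex_form_ends (d : vertex G -> R) (f : edge G -> R -> R) :
  \sum_v d v * vertex_sum v f = \sum_(e : edge G) (d (tgt e) * f e (elen e) + d (src e) * f e 0).
Proof.
transitivity (\sum_(p : edge_end G) d (end_vertex p) * end_val f p).
  rewrite (partition_big (@end_vertex R G) xpredT)//=; apply: eq_bigr => v _.
  by rewrite mulr_sumr; apply: eq_bigr => p /eqP ->.
rewrite -(pair_bigA_idem (op := +%R) _
  (fun e s => d (end_vertex (e, s)) * end_val f (e, s)))/=; last by rewrite addr0.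
by apply: eq_bigr => e _; rewrite big_bool.
Qed.

(** Integration by parts, that is, the fundamental theorem for [g1 * f e]. The derivative of [g] is
    passed as a separate [g1] because its end values occur and [derive1 (g e)] is meaningless
    there. *)
Lemma green f g (g1 g2 : R -> R) q e : (forall x, 0 < x < elen e -> derive1 (g e) x = g1 x) ->
  has_deriv (elen e) g1 g2 -> bcont (elen e) g2 -> bounded_potential q ->
  Int (elen e) (fun x => derive1 (g e) x * derive1 (f e) x + q e x * (g e x * f e x)) =
  g1 (elen e) * f e (elen e) - g1 0 * f e 0 +
  Int (elen e) (fun x => (q e x * g e x - g2 x) * f e x).
Proof.
move=> gg1 dg1 bg2 bq; have dp := has_derivM dg1 (gspace_der f e).
have bg1 := has_deriv_bcont (len_gt0 e) dg1.
have bf := gspace_bcont f e; have bf1 := gspace_bcont1 f e; have bg := gspace_bcont g e.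
have bh : bcont (elen e) (fun x => g2 x * f e x + g1 x * derive1 (f e) x).
  by apply: bcontD; exact: bcontM.
have bh2 : bcont (elen e) (fun x => (q e x * g e x - g2 x) * f e x).
  by apply: bcontM => //; apply: bcontB => //; exact: bcontM.
rewrite -(FTC (len_gt0 e) bh dp) -IntD//.
by apply: eq_Int => x xl; rewrite gg1//; ring.
Qed.

(** [u1] is a function of its own, continuous up to the ends, so that the vertex conditions can
    refer to its end values. *)
Definition real_eigenfunction q (beta mu : R) (u : gspace) : Prop :=
  exists u1 : gspace,
    [/\ forall e x, 0 < x < elen e -> derive1 (u e) x = u1 e x,
        forall e x, 0 < x < elen e -> derive1 (u1 e) x = (q e x - mu) * u e x &
        forall v, exists d, (forall p, end_vertex p = v -> end_slope u1 p = d) /\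
          vertex_sum v u = beta * d].

(** Common source of the weak equation for both couplings. The boundary terms of Green's formula
    collect at each vertex into the common derivative [d v] times the vertex sum of [h]. For
    [beta > 0] the conditions turn [d v] into [beta^-1] times the vertex sum of [u]; for [beta = 0]
    the term vanishes on functions with zero vertex sums. *)
Lemma eigenfunction_energy q beta mu u : bounded_potential q ->
  real_eigenfunction q beta mu u ->
  exists d : vertex G -> R, (forall v, vertex_sum v u = beta * d v) /\
    forall h, energy q u h = mu * ip u h - \sum_v d v * vertex_sum v h.
Proof.
move=> bq [u1 [uu1 u1u2 uv]]; have [d dP] := choice uv.
exists d; split=> [v|h]; first by case: (dP v).
have Eu e : Int (elen e) (fun x => derive1 (u e) x * derive1 (h e) x + q e x * (u e x * h e x)) =
   - (d (tgt e) * h e (elen e) + d (src e) * h e 0) + mu * Int (elen e) (fun x => u e x * h e x).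
  rewrite (green h (uu1 e) (gspace_der u1 e) (gspace_bcont1 u1 e) bq).
  have -> : u1 e (elen e) = - d (tgt e).
    by case: (dP (tgt e)) => /(_ (e, true) erefl) <- _; rewrite /end_slope/= opprK.
  have -> : u1 e 0 = d (src e).
    by case: (dP (src e)) => /(_ (e, false) erefl) <- _.
  rewrite -IntZ//; last by apply: bcontM; exact: gspace_bcont.
  rewrite mulNr -opprD; congr (_ + _).
  by apply: eq_Int => x xl; rewrite u1u2//; ring.
rewrite /energy (eq_bigr _ (fun e _ => Eu e)) big_split/= sumrN -vertex_form_ends.
by rewrite -mulr_sumr addrC.
Qed.

Definition delta_form q beta f g := energy q f g + beta^-1 * vertex_form f g.

Lemma symform_delta q beta : bounded_potential q -> symform (delta_form q beta).
Proof. by move=> bq; apply: symform_comb; [exact: symform_energy|exact: symform_vertex]. Qed.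

Lemma eigenfunction_delta q beta mu u h : bounded_potential q -> 0 < beta ->
  real_eigenfunction q beta mu u -> delta_form q beta u h = mu * ip u h.
Proof.
move=> bq b0 /(eigenfunction_energy bq)[d [dS E]].
rewrite /delta_form E /vertex_form -addrA [beta^-1 * _]mulr_sumr [- _ + _]addrC -sumrB.
rewrite big1 ?addr0// => v _.
by rewrite dS; field; rewrite gt_eqF.
Qed.

Lemma eigenfunction_anti_kirchhoff q mu u h : bounded_potential q ->
  real_eigenfunction q 0 mu u -> (forall v, vertex_sum v h = 0) ->
  energy q u h = mu * ip u h.
Proof.
move=> bq /(eigenfunction_energy bq)[d [dS ->]] hS.
by rewrite big1 ?subr0// => v _; rewrite hS mulr0.
Qed.

Lemma eigenfunction_vertex_sum0 q mu u v :
  real_eigenfunction q 0 mu u -> vertex_sum v u = 0.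
Proof. by move=> [u1 [_ _ /(_ v)[d [_ ->]]]]; rewrite mul0r. Qed.

Lemma real_eigenfunction_lin q beta mu a u w : real_eigenfunction q beta mu u ->
  real_eigenfunction q beta mu w -> real_eigenfunction q beta mu (a *: u + w).
Proof.
move=> [u1 [uu1 u1u2 uv]] [w1 [ww1 w1w2 wv]]; exists (a *: u1 + w1); split.
- by move=> e x xl; rewrite gspace_der_lin// gspaceE uu1// ww1.
- by move=> e x xl; rewrite gspace_der_lin// gspaceE u1u2// w1w2//; ring.
- move=> v; have [d [dp ds]] := uv v; have [d' [dp' ds']] := wv v.
  exists (a * d + d'); split; last by rewrite vertex_sum_lin ds ds'; ring.
  move=> p pv; rewrite -(dp p pv) -(dp' p pv) /end_slope; case: (p.2) => //.
  by rewrite gspaceE; ring.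
Qed.

Lemma real_eigenfunction0 q beta mu : real_eigenfunction q beta mu 0.
Proof.
have d0 e x : 0 < x < elen e -> derive1 ((0 : gspace) e) x = 0.
  exact: (has_deriv_der (has_deriv_cst (elen e) 0)).
exists 0; split => [e x /d0//|e x /d0->|v]; first by rewrite mulr0.
exists 0; split=> [p _|]; first by rewrite /end_slope; case: (p.2); rewrite ?oppr0.
by rewrite mulr0 /vertex_sum big1.
Qed.

Lemma ip_eq0 f : ip f f = 0 -> forall e x, 0 < x < elen e -> f e x = 0.
Proof.
move=> /eqP; rewrite psumr_eq0; last first.
  by move=> e _; apply: Int_ge0 => x _; rewrite -expr2 sqr_ge0.
move=> /allP H e x xl; have /eqP h := H e (mem_index_enum e).
have b2 : bcont (elen e) (fun x => f e x * f e x) by apply: bcontM; exact: gspace_bcont.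
have := Int_eq0 (len_gt0 e) b2 _ h xl => /(_ _)/eqP; rewrite mulf_eq0 orbb => k.
by apply/eqP/k => y _; rewrite -expr2 sqr_ge0.
Qed.

Lemma eigenvalue_orthogonal q beta mu nu u w : bounded_potential q -> 0 <= beta ->
  real_eigenfunction q beta mu u -> real_eigenfunction q beta nu w ->
  mu != nu -> ip u w = 0.
Proof.
move=> bq; rewrite le_eqVlt => b0 eu ew munu.
suff E : mu * ip u w = nu * ip u w.
  apply/eqP; have /eqP := E; rewrite -subr_eq0 -mulrBl mulf_eq0 subr_eq0.
  by rewrite (negbTE munu).
case/orP: b0 => [/eqP b0|b0]; last first.
  rewrite -(eigenfunction_delta _ bq b0 eu) (symform_delta beta bq).2.
  by rewrite (eigenfunction_delta _ bq b0 ew) symform_ip.2.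
rewrite -b0 in eu ew.
have Su v : vertex_sum v u = 0 by exact: eigenfunction_vertex_sum0 eu.
have Sw v : vertex_sum v w = 0 by exact: eigenfunction_vertex_sum0 ew.
rewrite -(eigenfunction_anti_kirchhoff bq eu Sw) (symform_ip.2 u w).
by rewrite -(eigenfunction_anti_kirchhoff bq ew Su); exact: (symform_energy bq).2.
Qed.

Lemma potential_bound q : bounded_potential q ->
  exists2 M, 0 <= M & forall e x, 0 < x < elen e -> `|q e x| <= M.
Proof.
move=> bq; have /choice[m mP] : forall e, exists M, forall x, 0 < x < elen e -> `|q e x| <= M.
  by move=> e; case: (bq e).
exists (\sum_e `|m e|); first by apply: sumr_ge0 => e _; exact: normr_ge0.
move=> e x xl; apply: le_trans (mP e x xl) _; apply: le_trans (ler_norm _) _.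
by rewrite (bigD1 e)//= lerDl sumr_ge0.
Qed.

Definition dirichlet f : R := \sum_e Int (elen e) (fun x => derive1 (f e) x ^+ 2).

Lemma energyE q f : bounded_potential q ->
  energy q f f = dirichlet f + \sum_e Int (elen e) (fun x => q e x * (f e x ^+ 2)).
Proof.
move=> bq; rewrite -big_split; apply: eq_bigr => e _ /=.
rewrite -IntD//.
- by apply: bcontM; exact: gspace_bcont1.
- by apply: bcontM; [exact: bq|apply: bcontM; exact: gspace_bcont].
Qed.

Lemma potential_term_le q M f : bounded_potential q ->
  (forall e x, 0 < x < elen e -> `|q e x| <= M) ->
  `|\sum_e Int (elen e) (fun x => q e x * (f e x ^+ 2))| <= M * ip f f.
Proof.
move=> bq qM; apply: le_trans (ler_norm_sum _ _ _) _; rewrite mulr_sumr.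
apply: ler_sum => e _.
have b2 : bcont (elen e) (fun x => f e x * f e x) by apply: bcontM; exact: gspace_bcont.
have b2q : bcont (elen e) (fun x => q e x * (f e x ^+ 2)) by apply: bcontM; [exact: bq|exact: b2].
have bound x : 0 < x < elen e -> `|q e x * f e x ^+ 2| <= M * (f e x * f e x).
  move=> xl; rewrite normrM [X in _ * X]ger0_norm ?sqr_ge0// expr2.
  by rewrite ler_wpM2r ?qM// -expr2 sqr_ge0.
rewrite -IntZ// ler_norml; apply/andP; split.
  rewrite -IntN; last exact: bcontZ.
  apply: (Int_le (len_gt0 e)) => //; first by apply: bcontN; exact: bcontZ.
  by move=> x /bound; rewrite ler_norml => /andP[].
  exact: len_gt0.
apply: (Int_le (len_gt0 e)) => //; first exact: bcontZ.
by move=> x /bound; rewrite ler_norml => /andP[].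
Qed.

Lemma energy_le q q' M M' f : bounded_potential q -> bounded_potential q' ->
  (forall e x, 0 < x < elen e -> `|q e x| <= M) ->
  (forall e x, 0 < x < elen e -> `|q' e x| <= M') ->
  energy q f f <= energy q' f f + (M + M') * ip f f.
Proof.
move=> bq bq' qM qM'; rewrite !energyE//.
have := potential_term_le f bq qM; have := potential_term_le f bq' qM'.
by rewrite !ler_norml; lra.
Qed.

Lemma energy_ge q M f : bounded_potential q ->
  (forall e x, 0 < x < elen e -> `|q e x| <= M) ->
  dirichlet f <= energy q f f + M * ip f f.
Proof.
by move=> bq qM; rewrite energyE//; have := potential_term_le f bq qM; rewrite ler_norml; lra.
Qed.

Lemma dirichlet_ge0 f : 0 <= dirichlet f.
Proof. by apply: sumr_ge0 => e _; apply: Int_ge0 => x _; exact: sqr_ge0. Qed.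

Lemma dirichlet_edge f e : Int (elen e) (fun x => derive1 (f e) x ^+ 2) <= dirichlet f.
Proof.
rewrite /dirichlet (bigD1 e)//= lerDl sumr_ge0// => e' _.
by apply: Int_ge0 => x _; exact: sqr_ge0.
Qed.

Lemma ip_edge f e : Int (elen e) (fun x => f e x ^+ 2) <= ip f f.
Proof.
rewrite /ip (bigD1 e)//= lerDl sumr_ge0// => e' _.
by apply: Int_ge0 => x _; rewrite -expr2 sqr_ge0.
Qed.

(** For [eps <= 1] one has [eps^-1 + l^-1 <= eps^-1 * (1 + l^-1)]; summing the inverse lengths
    serves all edges at once. *)
Definition sobolev_const : R := 1 + \sum_(e : edge G) (elen e)^-1.

Lemma sobolev_const_gt0 : 0 < sobolev_const.
Proof. by apply: ltr_wpDr => //; apply: sumr_ge0 => e _; rewrite invr_ge0 ltW// elen_gt0. Qed.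

Lemma point_sobolev f e x eps : 0 < eps -> eps <= 1 -> 0 <= x <= elen e ->
  (f e x) ^+ 2 <= sobolev_const * (eps * dirichlet f + eps^-1 * ip f f).
Proof.
move=> e0 e1 xl.
apply: le_trans (sobolev (len_gt0 e) (gspace_der f e) (gspace_bcont1 f e) e0 xl) _.
rewrite mulrDr; apply: lerD.
  apply: (@le_trans _ _ (eps * dirichlet f)); first by rewrite ler_pM2l// dirichlet_edge.
  rewrite ler_peMl//; first by rewrite mulr_ge0 ?dirichlet_ge0// ltW.
  by rewrite lerDl; apply: sumr_ge0 => e' _; rewrite invr_ge0 ltW// elen_gt0.
rewrite mulrA; apply: ler_pM => //.
- by rewrite addr_ge0// invr_ge0 ltW.
- by apply: Int_ge0 => y _; exact: sqr_ge0.
- rewrite /sobolev_const mulrDl mul1r lerD2l.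
  apply: (@le_trans _ _ (\sum_(e' : edge G) (elen e')^-1)).
    by rewrite (bigD1 e)//= lerDl sumr_ge0// => e' _; rewrite invr_ge0 ltW// elen_gt0.
  rewrite ler_peMr//; last by rewrite invf_ge1.
  by apply: sumr_ge0 => e' _; rewrite invr_ge0 ltW// elen_gt0.
- exact: ip_edge.
Qed.

Lemma end_sobolev f p eps : 0 < eps -> eps <= 1 ->
  (end_val f p) ^+ 2 <= sobolev_const * (eps * dirichlet f + eps^-1 * ip f f).
Proof.
move=> e0 e1; apply: point_sobolev => //.
by case: (p.2); rewrite ?lexx ?(ltW (len_gt0 _)).
Qed.

(** The number of ends enters twice: once from Cauchy-Schwarz on the sum, once from adding the
    bounds of all ends. *)
Lemma vertex_sobolev v f eps : 0 < eps -> eps <= 1 ->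
  (vertex_sum v f) ^+ 2 <=
  #|{: edge_end G}|%:R ^+ 2 * sobolev_const * (eps * dirichlet f + eps^-1 * ip f f).
Proof.
move=> e0 e1; set S := eps * _ + _.
have -> : vertex_sum v f = \sum_p (end_vertex p == v)%:R * end_val f p.
  rewrite /vertex_sum big_mkcond; apply: eq_bigr => p _.
  by case: ifP => _; rewrite ?mul1r ?mul0r.
apply: le_trans (sum_sqr_CS _ _) _; rewrite expr2 -!mulrA; apply: ler_pM.
- by apply: sumr_ge0 => p _; exact: sqr_ge0.
- by apply: sumr_ge0 => p _; exact: sqr_ge0.
- rewrite -sum1_card natr_sum; apply: ler_sum => p _.
  by case: eqP => _; rewrite ?expr1n ?expr0n//= ler01.
- rewrite -sum1_card natr_sum mulr_suml; apply: ler_sum => p _.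
  by rewrite mul1r; exact: end_sobolev.
Qed.

End graph_space.

(** * Uniform limits along an ultrafilter *)

Section uniform_limits.
Context (R : realType) (l : R) (l0 : 0 < l) (T : Type) (U : set_system T).
Implicit Types (f h : T -> R -> R) (g k : R -> R).

Definition ucvg f g : Prop := forall eps, 0 < eps ->
  \forall t \near U, forall x, 0 <= x <= l -> `|f t x - g x| <= eps.

(** Compactness of [[-B, B]] gives a pointwise limit along the ultrafilter at every point at once.
    The limit inherits the modulus of continuity, and comparison on a finite grid makes the
    convergence uniform. *)
Lemma ultra_ascoli f B : UltraFilter U ->
  (forall t x, 0 <= x <= l -> `|f t x| <= B) ->
  (forall eps, 0 < eps -> exists2 d, 0 < d & forall t x y, 0 <= x <= l -> 0 <= y <= l ->
     `|y - x| <= d -> `|f t y - f t x| <= eps) ->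
  exists2 g, {within `[0, l], continuous g} & ucvg f g.
Proof.
move=> UU fB fequi.
have /choice[g gP] : forall x : R, exists y : R, 0 <= x <= l -> f t x @[t --> U] --> y.
  move=> x; have [xl|] := boolP (0 <= x <= l); last by exists 0.
  have bnd : \forall t \near U, f t x \in `[- B, B].
    by apply: filterE => t; rewrite in_itv/= -ler_norml; exact: fB.
  have [y [_ yc]] := @segment_compact R (- B) B _ (fmap_proper_filter (f^~ x) _) bnd.
  exists y => _ N Ny; have [//|NU] := in_ultra_setVsetC (f^~ x @^-1` N) UU.
  have [z [Nz1 Nz2]] := yc (~` N) N NU Ny.
  by case: Nz1.
have gequi eps : 0 < eps -> exists2 d, 0 < d & forall x y, 0 <= x <= l -> 0 <= y <= l ->
     `|y - x| <= d -> `|g y - g x| <= eps.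
  move=> e0; have [d d0 hd] := fequi _ e0; exists d => // x y xl yl yx.
  have c : `|f t y - f t x| @[t --> U] --> `|g y - g x|.
    by apply: cvg_norm; apply: cvgB; exact: gP.
  by apply: (cvgr_to_le c); apply: filterE => t; exact: hd.
exists g.
  apply/subspace_continuousP => x; rewrite /= in_itv/= => xl.
  apply/cvgrPdist_le => eps e0; have [d d0 hd] := gequi _ e0.
  rewrite near_withinE; have xd : \forall y \near x, `|x - y| <= d.
    by apply: (@cvgr_dist_le _ _ _ (nbhs x) _ id) => //; exact: cvg_id.
  apply: filterS xd => y /= xy; rewrite in_itv/= => yl.
  exact: hd.
move=> eps e0; have e3 : 0 < eps / 3 by lra.
have [d d0 hd] := fequi _ e3; have [d' d'0 hd'] := gequi _ e3.
set d1 := Num.min d d'; have d10 : 0 < d1 by rewrite lt_min d0 d'0.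
pose n := (Num.trunc (l / d1)).+1.
have hn : l / n%:R <= d1.
  by rewrite ler_pdivrMr// mulrC -ler_pdivrMr// ltW// truncnS_gt.
pose p (i : 'I_n.+1) := i%:R * (l / n%:R).
have n0 : (0 : R) < n%:R by rewrite ltr0n.
have pl i : 0 <= p i <= l.
  apply/andP; split; first by rewrite mulr_ge0// divr_ge0// ltW.
  rewrite /p mulrA ler_pdivrMr// mulrC ler_pM2l// ler_nat.
  by rewrite -ltnS.
have : \forall t \near U, forall i, `|f t (p i) - g (p i)| <= eps / 3.
  apply: filter_forall => i; have /cvgrPdist_le/(_ _ e3) := gP _ (pl i).
  by apply: filterS => t; rewrite distrC.
apply: filterS => t ht x xl.
have /andP[x0 xl'] := xl.
have jn : (Num.trunc (x / (l / n%:R)) < n.+1)%N.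
  rewrite ltnS -(ler_nat R); apply: (@le_trans _ _ (x / (l / n%:R))).
    by rewrite truncn_le divr_ge0// divr_ge0// ltW.
  by rewrite ler_pdivrMr ?divr_gt0// mulrCA divff ?gt_eqF// mulr1.
(* The grid point just to the left of [x], at distance less than one mesh [l / n <= d1]. *)
pose i : 'I_n.+1 := Ordinal jn.
have xi : `|x - p i| <= d1.
  have ln0 : 0 < l / n%:R by rewrite divr_gt0.
  have /andP[] := truncn_itv (divr_ge0 x0 (ltW ln0)).
  rewrite (ler_pdivlMr _ _ ln0) (ltr_pdivrMr _ _ ln0) => h1 h2.
  apply: le_trans _ hn; rewrite ger0_norm ?subr_ge0//.
  by move: h2; rewrite -natr1 mulrDl mul1r /p /=; lra.
have h1 := hd t _ _ (pl i) xl; have h2 := hd' _ _ (pl i) xl; have h3 := ht i.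
have {}h1 : `|f t x - f t (p i)| <= eps / 3 by apply: h1; rewrite (le_trans xi)// /d1 ge_min lexx.
have {}h2 : `|g x - g (p i)| <= eps / 3 by apply: h2; rewrite (le_trans xi)// /d1 ge_min lexx orbT.
move: h1 h2 h3; rewrite !ler_norml; lra.
Qed.

Context (FU : Filter U).

Lemma ucvg_cst g : ucvg (fun=> g) g.
Proof. by move=> eps e0; apply: filterE => t x _; rewrite subrr normr0 ltW. Qed.

Lemma ucvg_point f g x : ucvg f g -> 0 <= x <= l -> f t x @[t --> U] --> g x.
Proof.
move=> fg xl; apply/cvgrPdist_le => eps e0; apply: filterS (fg _ e0) => t.
by rewrite distrC; apply.
Qed.

Lemma ucvgM f g h k M M' : ucvg f g -> ucvg h k ->
  (forall x, 0 <= x <= l -> `|g x| <= M) -> (forall x, 0 <= x <= l -> `|k x| <= M') ->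
  ucvg (fun t x => f t x * h t x) (fun x => g x * k x).
Proof.
move=> fg hk gM kM eps e0.
have M1 : 0 < `|M| + `|M'| + 2 by rewrite ltr_wpDl ?addr_ge0.
pose e := Num.min 1 (eps / (`|M| + `|M'| + 2)).
have e00 : 0 < e by rewrite lt_min ltr01 divr_gt0.
have ee : e * (`|M| + `|M'| + 2) <= eps.
  by rewrite -ler_pdivlMr// ge_min lexx orbT.
have e1 : e <= 1 by rewrite ge_min lexx.
apply: filterS2 (fg _ e00) (hk _ e00) => t ht kt x xl.
have {}ht := ht x xl; have {}kt := kt x xl; have {}gM := gM x xl; have {}kM := kM x xl.
have -> : f t x * h t x - g x * k x =
    (f t x - g x) * (h t x - k x) + (f t x - g x) * k x + g x * (h t x - k x) by ring.
apply: le_trans (ler_normD _ _) _.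
have := ler_normD ((f t x - g x) * (h t x - k x)) ((f t x - g x) * k x).
rewrite !normrM => h1.
have h2 : `|f t x - g x| * `|h t x - k x| <= e * 1 by apply: ler_pM => //; exact: le_trans kt e1.
have h3 : `|f t x - g x| * `|k x| <= e * `|M'|.
  by apply: ler_pM => //; apply: le_trans kM (ler_norm _).
have h4 : `|g x| * `|h t x - k x| <= `|M| * e.
  by apply: ler_pM => //; apply: le_trans gM (ler_norm _).
lra.
Qed.

Lemma ucvg_Int f g : (forall t, bcont l (f t)) -> bcont l g -> ucvg f g ->
  Int l (f t) @[t --> U] --> Int l g.
Proof.
move=> bf bg fg; apply/cvgrPdist_le => eps e0.
have e' : 0 < eps / l by rewrite divr_gt0.
apply: filterS (fg _ e') => t ht.
rewrite -IntB//.
have H x : 0 < x < l -> - (eps / l) <= g x - f t x <= eps / l.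
  by move=> /andP[x0 xl]; rewrite -ler_norml distrC ht// !ltW.
rewrite ler_norml; apply/andP; split.
  have -> : - eps = Int l (fun=> - (eps / l)) by rewrite Int_cst// mulNr divfK// gt_eqF.
  by apply: Int_le => //; [exact: bcont_cst|exact: bcontB|move=> x /H/andP[]].
have -> : eps = Int l (fun=> (eps / l)) by rewrite Int_cst// divfK// gt_eqF.
by apply: Int_le => //; [exact: bcontB|exact: bcont_cst|move=> x /H/andP[]].
Qed.

End uniform_limits.

Lemma bcont_closed_bound (R : realType) (l : R) (h : R -> R) : bcont l h ->
  exists M, forall x, 0 <= x <= l -> `|h x| <= M.
Proof.
move=> [_ [M hM]]; exists (`|M| + `|h 0| + `|h l|) => x /andP[].
have := normr_ge0 M; have := normr_ge0 (h 0); have := normr_ge0 (h l) => a1 a2 a3.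
rewrite le_eqVlt => /predU1P[<- _|x0]; first by lra.
rewrite le_eqVlt => /predU1P[->|xl]; first by lra.
by have := hM x; rewrite x0 xl => /(_ isT); have := ler_norm M; lra.
Qed.

Lemma cvg_bigsum (R : realType) (T : Type) (U : set_system T) (I : finType)
    (P : pred I) (f : I -> T -> R) (a : I -> R) : Filter U ->
  (forall i, P i -> f i t @[t --> U] --> a i) ->
  \sum_(i | P i) f i t @[t --> U] --> \sum_(i | P i) a i.
Proof. by move=> FU fa; apply: cvg_big => //; exact: add_continuous. Qed.

(** * Existence of eigenfunctions *)

Section single_edge.
Context (R : realType) (G : metric_graph R) (e0 : edge G).
Notation l := (elen e0).

Lemma single_edge_fun (w w1 : R -> R) : has_deriv l w w1 -> bcont l w1 ->
  exists f : gspace G, forall e x, f e x = if e == e0 then w x else 0.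
Proof.
move=> dw bw; pose f (e : edge G) (x : R) : R := if e == e0 then w x else 0.
have rf : f \in @regular_pred R G.
  apply/asboolP => e; rewrite /f; have [->|_] := eqVneq e e0; first by exists w1.
  by exists (fun=> 0); [exact: has_deriv_cst|exact: bcont_cst].
by exists (GSpace rf).
Qed.

Lemma monomial_deriv (j : nat) :
  exists2 g, has_deriv l (fun x => x ^+ j) g & bcont l g.
Proof.
elim: j => [|j [g dg bg]].
  exists (fun=> 0); last exact: bcont_cst.
  by under eq_fun do rewrite expr0; exact: has_deriv_cst.
exists (fun x => 1 * x ^+ j + x * g x).
  under eq_fun do rewrite exprS; exact: has_derivM (has_deriv_id _) dg.
have l0 := elen_gt0 e0.
apply: bcontD; first by apply: bcontM; [exact: bcont_cst|exact: has_deriv_bcont dg].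
by apply: bcontM => //; exact: has_deriv_bcont (has_deriv_id _).
Qed.

(** Infinite dimensionality of the space: among [m.+1] monomials on one edge some nontrivial
    combination meets the [m] orthogonality conditions. It keeps the set of Rayleigh quotients
    nonempty at every stage. *)
Lemma ortho_unit_vector m (o : 'I_m -> gspace G) :
  exists2 f : gspace G, (forall i, ip (o i) f = 0) & ip f f = 1.
Proof.
have l0 := elen_gt0 e0.
have /choice[F FE] (j : 'I_m.+1) : exists f : gspace G,
    forall e x, f e x = if e == e0 then x ^+ j else 0.
  by have [g dg bg] := monomial_deriv j; exact: (single_edge_fun dg bg).
have [c c0 cA] := left_kernel_vector (\matrix_(j < m.+1, i < m) ip (o i) (F j)) (ltnSn m).
pose f : gspace G := \sum_j c 0 j *: F j.
have fo i : ip (o i) f = 0.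
  rewrite symform_sumr; last exact: symform_ip.
  have /matrixP/(_ 0 i) := cA; rewrite !mxE => h; rewrite -[RHS]h.
  by apply: eq_bigr => j _; rewrite mxE symformZr//; exact: symform_ip.
have fE x : f e0 x = \sum_j c 0 j * x ^+ j.
  rewrite /f; elim/big_rec2: _ => [//|j y u _ <-].
  by rewrite gspaceE FE eqxx.
have fpos : 0 < ip f f.
  rewrite lt_def ip_ge0 andbT; apply/eqP => /ip_eq0 f0.
  pose p := \poly_(j < m.+1) (c 0 (inord j)).
  have pE x : p.[x] = f e0 x.
    rewrite fE horner_poly; apply: eq_bigr => j _; by rewrite inord_val.
  have p0 : p = 0.
    apply/eqP; apply: contraT => pn0.
    (* These are [m.+1] distinct points inside the edge, one more than the degree of [p] allows; the
       shift by 2 keeps them away from the end [l]. *)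
    pose rs := [seq l / (i.+2)%:R | i <- iota 0 m.+1] : seq R.
    have := max_poly_roots pn0 (rs := rs).
    rewrite size_map size_iota => h.
    have : (m.+1 < size p)%N.
      apply: h.
        apply/allP => y /mapP[i _ ->]; rewrite rootE pE f0// divr_gt0//=.
        by rewrite ltr_pdivrMr// ltr_pMr// ltr1n.
      rewrite map_inj_uniq ?iota_uniq// => i j /(mulfI _)/invr_inj h.
      have /eqP : (i.+2)%:R = (j.+2)%:R :> R by apply: h; rewrite gt_eqF.
      by rewrite eqr_nat => /eqP[].
    by rewrite ltnNge (leq_trans (size_poly _ _)).
  case/eqP: c0; apply/rowP => j; rewrite mxE.
  have := coef_poly m.+1 (fun j => c 0 (inord j)) j; rewrite -/p p0 coef0 ltn_ord inord_val.
  by move=> <-.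
pose t := (Num.sqrt (ip f f))^-1.
exists (t *: f) => [i|]; first by rewrite symformZr ?fo ?mulr0//; exact: symform_ip.
rewrite symformZl; last exact: symform_ip.
rewrite symformZr; last exact: symform_ip.
by rewrite mulrA -invfM -expr2 sqr_sqrtr ?ip_ge0// mulVf// gt_eqF.
Qed.

End single_edge.

(** * Regularity of weak solutions *)

Section weak_solution.
Context (R : realType) (G : metric_graph R) (q : edge G -> R -> R).
Hypothesis bq : bounded_potential q.
Context (beta mu : R) (b0 : 0 < beta) (s : edge G -> R -> R).
Hypothesis cs : forall e, {within `[0, elen e], continuous (s e)}.
(** All derivatives are on the test function, so the equation makes sense for a merely continuous
    [s] and passes to uniform limits. *)
Hypothesis weak : forall phi phi1 : gspace G,
  (forall e x, 0 < x < elen e -> derive1 (phi e) x = phi1 e x) ->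
  \sum_e (phi1 e (elen e) * s e (elen e) - phi1 e 0 * s e 0 +
     Int (elen e) (fun x => (q e x * phi e x - derive1 (phi1 e) x) * s e x)) +
  beta^-1 * \sum_v vertex_sum v phi * vertex_sum v s =
  mu * \sum_e Int (elen e) (fun x => phi e x * s e x).

Let p e x := (q e x - mu) * s e x.

Let bs e : bcont (elen e) (s e).
Proof. exact: (within_bcont (elen_gt0 e) (@cs e)). Qed.

Let bp e : bcont (elen e) (p e).
Proof. by apply: bcontM => //; apply: bcontB (bcont_cst _ _); exact: bq. Qed.

Let weak_edge e (w w1 w2 : R -> R) : has_deriv (elen e) w w1 ->
  has_deriv (elen e) w1 w2 -> bcont (elen e) w2 ->
  w1 (elen e) * s e (elen e) - w1 0 * s e 0 +
  (Int (elen e) (fun x => p e x * w x) - Int (elen e) (fun x => w2 x * s e x)) +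
  beta^-1 * (vertex_sum (tgt e) s * w (elen e) + vertex_sum (src e) s * w 0) = 0.
Proof.
move=> dw dw1 bw2; have l0 := elen_gt0 e.
have bw1 := has_deriv_bcont l0 dw1; have bw := has_deriv_bcont l0 dw.
have [phi phiE] := single_edge_fun dw bw1.
have [phi1 phi1E] := single_edge_fun dw1 bw2.
have phie : phi e = w by apply/funext => x; rewrite phiE eqxx.
have phi1e : phi1 e = w1 by apply/funext => x; rewrite phi1E eqxx.
have phin e' : e' != e -> phi e' = fun=> 0.
  by move=> ee; apply/funext => x; rewrite phiE (negbTE ee).
have phi1n e' : e' != e -> phi1 e' = fun=> 0.
  by move=> ee; apply/funext => x; rewrite phi1E (negbTE ee).
have d0 (e' : edge G) x : 0 < x < elen e' -> derive1 (fun=> 0 : R) x = 0.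
  exact: has_deriv_der (has_deriv_cst _ _).
have I0 (e' : edge G) : Int (elen e') (fun=> 0) = 0 by rewrite Int_cst ?mul0r ?elen_gt0.
have sum1 (F : edge G -> R) : (forall e', e' != e -> F e' = 0) -> \sum_e' F e' = F e.
  by move=> F0; rewrite (bigD1 e)//= big1 ?addr0.
have der e' x : 0 < x < elen e' -> derive1 (phi e') x = phi1 e' x.
  have [->|ee] := eqVneq e' e; first by rewrite phie phi1e; exact: has_deriv_der.
  by rewrite phin// phi1n//; exact: d0.
have := weak der.
rewrite (eq_bigr (fun v => vertex_sum v s * vertex_sum v phi)); last by move=> v _; rewrite mulrC.
rewrite (vertex_form_ends (fun v => vertex_sum v s)).
rewrite [X in beta^-1 * X]sum1; last by move=> e' ee; rewrite phin// !mulr0 addr0.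
rewrite [X in mu * X]sum1; last first.
  by move=> e' ee; rewrite phin// -[RHS](I0 e'); apply: eq_Int => x _; rewrite mul0r.
rewrite [X in X + _ = _]sum1; last first.
  move=> e' ee; rewrite phi1n// !mul0r subrr add0r phin//.
  by rewrite -[RHS](I0 e'); apply: eq_Int => x xl; rewrite (d0 e' x xl) mulr0 subrr mul0r.
rewrite phie phi1e => H.
have b1 : bcont (elen e) (fun x => w x * s e x) by apply: bcontM.
have b2 : bcont (elen e) (fun x => p e x * w x) by apply: bcontM.
have b3 : bcont (elen e) (fun x => w2 x * s e x) by apply: bcontM.
have E : Int (elen e) (fun x => p e x * w x) - Int (elen e) (fun x => w2 x * s e x) =
   Int (elen e) (fun x => (q e x * w x - derive1 w1 x) * s e x) -
   mu * Int (elen e) (fun x => w x * s e x).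
  rewrite -IntZ// -!IntB//.
  - by apply: eq_Int => x xl; rewrite (has_deriv_der dw1)// /p; ring.
  - apply: (@bcont_eq _ _ (fun x => (q e x * w x - w2 x) * s e x)).
      by move=> x xl; rewrite (has_deriv_der dw1).
    by apply: bcontM => //; apply: bcontB => //; apply: bcontM => //; exact: bq.
  - exact: bcontZ.
rewrite E; move: H; lra.
Qed.

Let S v := vertex_sum v s.
(* The solution of [F'' = (q - mu) s] with the boundary data imposed at the
   source; testing the weak equation against [w] with [w'' = F - s] gives [F = s]. *)
Let F1 e x := beta^-1 * S (src e) + prim (elen e) (p e) x.
Let F e x := s e 0 + prim (elen e) (F1 e) x.

Let dF1 e : has_deriv (elen e) (F1 e) (p e).
Proof.
have l0 := elen_gt0 e.
apply: has_deriv_eq (has_derivD (has_deriv_cst _ _) (prim_has_deriv l0 (bp e))) => x _.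
by rewrite add0r.
Qed.

Let bF1 e : bcont (elen e) (F1 e).
Proof. exact: (has_deriv_bcont (elen_gt0 e) (dF1 e)). Qed.

Let dF e : has_deriv (elen e) (F e) (F1 e).
Proof.
have l0 := elen_gt0 e.
apply: has_deriv_eq (has_derivD (has_deriv_cst _ _) (prim_has_deriv l0 (bF1 e))) => x _.
by rewrite add0r.
Qed.

Let bF e : bcont (elen e) (F e).
Proof. exact: (has_deriv_bcont (elen_gt0 e) (dF e)). Qed.

Let F10 e : F1 e 0 = beta^-1 * S (src e). Proof. by rewrite /F1 prim0 addr0. Qed.
Let F0 e : F e 0 = s e 0. Proof. by rewrite /F prim0 addr0. Qed.

(** The weak equation for [s] compared with integration by parts for [F]: only [F - s] inside, and
    the mismatch of boundary data at the target end, are left. *)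
Let weak_defect e (w w1 w2 : R -> R) : has_deriv (elen e) w w1 ->
  has_deriv (elen e) w1 w2 -> bcont (elen e) w2 ->
  Int (elen e) (fun x => (F e x - s e x) * w2 x) +
  (s e (elen e) - F e (elen e)) * w1 (elen e) +
  (F1 e (elen e) + beta^-1 * S (tgt e)) * w (elen e) = 0.
Proof.
move=> dw dw1 bw2; have l0 := elen_gt0 e; have := weak_edge dw dw1 bw2.
have bw1 := has_deriv_bcont l0 dw1; have bw := has_deriv_bcont l0 dw.
have dd := has_derivB (has_derivM (dF1 e) dw) (has_derivM (dF e) dw1).
have b2 : bcont (elen e) (fun x => p e x * w x) by apply: bcontM.
have b3 : bcont (elen e) (fun x => w2 x * s e x) by apply: bcontM.
have b4 : bcont (elen e) (fun x => F e x * w2 x) by apply: bcontM.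
have b5 : bcont (elen e) (fun x => p e x * w x - F e x * w2 x) by apply: bcontB.
have dd' : has_deriv (elen e) (fun x => F1 e x * w x - F e x * w1 x)
    (fun x => p e x * w x - F e x * w2 x).
  by apply: has_deriv_eq dd => x _; ring.
have := FTC l0 b5 dd'; rewrite IntB// F10 F0.
have -> : Int (elen e) (fun x => (F e x - s e x) * w2 x) =
    Int (elen e) (fun x => F e x * w2 x) - Int (elen e) (fun x => w2 x * s e x).
  by rewrite -IntB//; apply: eq_Int => x _; ring.
rewrite -/(S (tgt e)) -/(S (src e)) => h1 h2.
have := congr2 +%R h1 h2; lra.
Qed.

Let F_open e x : 0 < x < elen e -> F e x = s e x.
Proof.
move=> xl; have l0 := elen_gt0 e.
pose d x := F e x - s e x.
have bd : bcont (elen e) d by exact: bcontB.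
(* The constants of integration make [w1] and [w] vanish at the target end, which removes both
   boundary terms and leaves the integral of [d ^+ 2]. *)
pose w1 x := prim (elen e) d x - Int (elen e) d.
have dw1 : has_deriv (elen e) w1 d.
  apply: has_deriv_eq (has_derivB (prim_has_deriv l0 bd) (has_deriv_cst _ _)) => y _.
  by rewrite subr0.
have bw1 := has_deriv_bcont l0 dw1.
pose w x := prim (elen e) w1 x - Int (elen e) w1.
have dw : has_deriv (elen e) w w1.
  apply: has_deriv_eq (has_derivB (prim_has_deriv l0 bw1) (has_deriv_cst _ _)) => y _.
  by rewrite subr0.
have := weak_defect dw dw1 bd.
rewrite [w1 (elen e)]/w1 prim_l// subrr mulr0 addr0.
rewrite [w (elen e)]/w prim_l// subrr mulr0 addr0 => Id.
have bdd : bcont (elen e) (fun x => d x * d x) by exact: bcontM.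
have dd0 y : 0 < y < elen e -> 0 <= d y * d y by move=> _; rewrite -expr2 sqr_ge0.
have /eqP := Int_eq0 l0 bdd dd0 Id xl.
by rewrite mulf_eq0 orbb subr_eq0 => /eqP.
Qed.

(** Affine test functions see only the target end: [w = 1] yields the slope condition there, then
    [w = id] the value. *)
Let defect_ends e (w w1 : R -> R) : has_deriv (elen e) w w1 -> has_deriv (elen e) w1 (fun=> 0) ->
  (s e (elen e) - F e (elen e)) * w1 (elen e) +
  (F1 e (elen e) + beta^-1 * S (tgt e)) * w (elen e) = 0.
Proof.
move=> dw dw1; have := weak_defect dw dw1 (bcont_cst _ 0).
have -> : Int (elen e) (fun x => (F e x - s e x) * 0) = 0.
  have l0 := elen_gt0 e.
  by rewrite (eq_Int (h := fun=> 0)) ?Int_cst ?mul0r// => x _; rewrite mulr0.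
by rewrite add0r.
Qed.

Let F1_l e : F1 e (elen e) = - (beta^-1 * S (tgt e)).
Proof.
have := defect_ends (has_deriv_cst (elen e) 1) (has_deriv_cst _ 0).
by rewrite mulr0 add0r mulr1 => /eqP; rewrite addr_eq0 => /eqP.
Qed.

Let F_l e : F e (elen e) = s e (elen e).
Proof.
have := defect_ends (has_deriv_id (elen e)) (has_deriv_cst _ 1).
by rewrite F1_l addNr mul0r addr0 mulr1 => /eqP; rewrite subr_eq0 => /eqP.
Qed.

Let F_closed e x : 0 <= x <= elen e -> F e x = s e x.
Proof.
move=> /andP[]; rewrite le_eqVlt => /predU1P[<- _|x0]; first exact: F0.
rewrite le_eqVlt => /predU1P[->|xl]; first exact: F_l.
by rewrite F_open// x0.
Qed.

Lemma weak_solution_regular : exists u : gspace G,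
  real_eigenfunction q beta mu u /\ forall e x, 0 <= x <= elen e -> u e x = s e x.
Proof.
have rF : F \in @regular_pred R G by apply/asboolP => e; exists (F1 e).
have rF1 : F1 \in @regular_pred R G by apply/asboolP => e; exists (p e).
exists (GSpace rF); split=> //; exists (GSpace rF1); split.
- by move=> e x xl; exact: (has_deriv_der (dF e) xl).
- move=> e x xl; transitivity (p e x); first exact: (has_deriv_der (dF1 e) xl).
  by rewrite /p -F_open.
(* The vertex conditions are natural boundary conditions: the weak equation forces the slope
   [beta^-1 * S v] into every edge at [v]. *)
- move=> v; exists (beta^-1 * S v); split.
    move=> [e [|]] <-; rewrite /end_slope/=.
      by rewrite -/(F1 e (elen e)) F1_l opprK.
    by rewrite -/(F1 e 0) F10.
  rewrite mulrA divff ?mul1r ?gt_eqF//; apply: eq_bigr => -[e t] _.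
  by rewrite /end_val/= -/(F e _); apply: F_closed; case: t; rewrite ?lexx ?(ltW (elen_gt0 e)).
Qed.

End weak_solution.

(** * Minimizers of the Rayleigh quotient on an orthogonal complement *)

Section minimization.
Context (R : realType) (G : metric_graph R) (q : edge G -> R -> R).
Hypothesis bq : bounded_potential q.
Context (beta : R) (b0 : 0 < beta).
Notation b := (delta_form q beta).

Lemma delta_form_ge M (f : gspace G) : (forall e x, 0 < x < elen e -> `|q e x| <= M) ->
  dirichlet f <= b f f + M * ip f f.
Proof.
move=> qM; apply: le_trans (energy_ge f bq qM) _.
by rewrite lerD2r /delta_form lerDl mulr_ge0 ?vertex_form_ge0// invr_ge0 ltW.
Qed.

Context (m : nat) (o : 'I_m -> gspace G) (nu : 'I_m -> R).
Hypothesis oo : orthonormal_family (@ip R G) o.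
Hypothesis oe : forall i, real_eigenfunction q beta (nu i) (o i).

Let Y (f : gspace G) := forall i, ip (o i) f = 0.
Let E := [set b f f | f in [set f | Y f /\ ip f f = 1]].
Let mu0 := inf E.

Let hasinf (e0 : edge G) : has_inf E.
Proof.
have [M M0 qM] := potential_bound bq.
have [f fY f1] := ortho_unit_vector e0 o.
split; first by exists (b f f), f.
exists (- M) => _ [g [gY g1] <-].
have := delta_form_ge g qM; have := dirichlet_ge0 g; rewrite g1; lra.
Qed.

Lemma rayleigh_inf_le (e0 : edge G) f : Y f -> mu0 * ip f f <= b f f.
Proof.
move=> fY; have [f0|f0] := eqVneq (ip f f) 0.
  have [M M0 qM] := potential_bound bq.
  by have := delta_form_ge f qM; have := dirichlet_ge0 f; rewrite f0 !mulr0; lra.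
have fpos : 0 < ip f f by rewrite lt_def f0 ip_ge0.
rewrite -ler_pdivlMr//; apply: ge_inf; first by case: (hasinf e0).
have t2 : (Num.sqrt (ip f f))^-1 * (Num.sqrt (ip f f))^-1 = (ip f f)^-1.
  by rewrite -invfM -expr2 sqr_sqrtr ?ip_ge0.
exists ((Num.sqrt (ip f f))^-1 *: f).
  split; first by move=> i; rewrite symformZr ?fY ?mulr0//; exact: symform_ip.
  rewrite symformZl; last exact: symform_ip.
  rewrite symformZr; last exact: symform_ip.
  by rewrite mulrA t2 mulVf.
rewrite symformZl; last exact: symform_delta.
rewrite symformZr; last exact: symform_delta.
by rewrite mulrA t2 mulrC.
Qed.

(** A minimizing sequence has bounded energy, so it is bounded and equicontinuous. Its limit is only
    known to be continuous; the Euler-Lagrange equation is passed to the limit in weak form and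
    regularity is recovered from it. *)
Lemma rayleigh_minimizer (e0 : edge G) : exists u : gspace G,
  [/\ real_eigenfunction q beta mu0 u, Y u & ip u u = 1].
Proof.
have [M M0 qM] := potential_bound bq.
have /choice[phi phiP] : forall k : nat, exists f : gspace G,
    [/\ Y f, ip f f = 1 & b f f <= mu0 + k.+1%:R^-1].
  move=> k.
  have k0 : (0 : R) < k.+1%:R^-1 by rewrite invr_gt0.
  have [_ [f [fY f1] <-] fk] := inf_adherent k0 (hasinf e0).
  by exists f; split => //; exact: ltW.
have phiY k : Y (phi k) by case: (phiP k).
have phi1 k : ip (phi k) (phi k) = 1 by case: (phiP k).
have phib k : b (phi k) (phi k) <= mu0 + k.+1%:R^-1 by case: (phiP k).
pose D := mu0 + 1 + M.
have phiD k : dirichlet (phi k) <= D.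
  apply: le_trans (delta_form_ge (phi k) qM) _; rewrite phi1 mulr1 lerD2r.
  apply: le_trans (phib k) _; rewrite lerD2l invf_le1//; by rewrite ler1n.
have D0 : 0 <= D by apply: le_trans _ (phiD 0%N); exact: dirichlet_ge0.
have [U [UU subU]] := ultraFilterLemma (@eventually_filter).
have UF : ProperFilter U by case: UU.
have FU : Filter U by exact: UF.
pose C := sobolev_const G.
have C0 : 0 < C by exact: sobolev_const_gt0.
have phiB k e x : 0 <= x <= elen e -> `|phi k e x| <= 1 + C * (D + 1).
  move=> xl; have := point_sobolev (phi k) ltr01 (lexx _) xl.
  rewrite invr1 !mul1r phi1 -/C => h.
  have h2 : C * (dirichlet (phi k) + 1) <= C * (D + 1) by rewrite ler_pM2l// lerD2r.
  have h3 : `|phi k e x| <= 1 + (phi k e x) ^+ 2.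
    have : 0 <= (`|phi k e x| - 1) ^+ 2 by exact: sqr_ge0.
    rewrite -[X in _ <= 1 + X]real_normK ?num_real// !expr2.
    have := normr_ge0 (phi k e x); nra.
  lra.
have /choice[s sP] : forall e, exists s : R -> R,
    {within `[0, elen e], continuous s} /\ ucvg (elen e) U (fun k => phi k e) s.
  move=> e.
  have [||s cs us] := @ultra_ascoli _ _ (elen_gt0 e) _ U (fun k => phi k e)
    (1 + C * (D + 1)) UU.
  - by move=> k x xl; exact: phiB.
  (* [eta] makes the energy term at most [eps / 2]; the distance [eta * (eps / 2)] does the same for
     the other term of [equicontinuity]. *)
  - move=> eps eps0; pose eta := eps / (2 * (D + 1)).
    have D1 : 0 < D + 1 by rewrite ltr_wpDl.
    have eta0 : 0 < eta by rewrite divr_gt0 ?mulr_gt0.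
    exists (eta * (eps / 2)); first by rewrite mulr_gt0// divr_gt0.
    move=> k x y xl yl xy.
    apply: le_trans (equicontinuity (elen_gt0 e) (gspace_der (phi k) e)
      (gspace_bcont1 _ e) eta0 xl yl) _.
    have h1 : eta * Int (elen e) (fun t => derive1 (phi k e) t ^+ 2) <= eta * D.
      by rewrite ler_pM2l//; apply: le_trans _ (phiD k); exact: dirichlet_edge.
    have h2 : eta^-1 * `|y - x| <= eps / 2 by rewrite ler_pdivrMl.
    have h3 : eta * D <= eps / 2.
      have -> : eps / 2 = eta * (D + 1) by rewrite /eta; field; rewrite gt_eqF.
      by rewrite ler_pM2l// lerDl.
    lra.
  by exists s.
have cs e : {within `[0, elen e], continuous (s e)} by case: (sP e).
have us e : ucvg (elen e) U (fun k => phi k e) (s e) by case: (sP e).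
have bs e : bcont (elen e) (s e) by exact: (within_bcont (elen_gt0 e) (@cs e)).
have pt e x : 0 <= x <= elen e -> phi k e x @[k --> U] --> s e x.
  by move=> xl; exact: (ucvg_point FU (us e) xl).
have l0e (e : edge G) : 0 <= (0 : R) <= elen e by rewrite lexx ltW ?elen_gt0.
have lle (e : edge G) : 0 <= elen e <= elen e by rewrite lexx ltW ?elen_gt0.
have lim_Int e h : bcont (elen e) h ->
    Int (elen e) (fun x => h x * phi k e x) @[k --> U] --> Int (elen e) (fun x => h x * s e x).
  move=> bh; have [M1 hM] := bcont_closed_bound bh; have [M2 sM] := bcont_closed_bound (bs e).
  apply: ucvg_Int; first exact: elen_gt0.
  - by move=> k; apply: bcontM => //; exact: gspace_bcont.
  - exact: bcontM.
  - exact: (ucvgM FU (ucvg_cst _ FU h) (us e) hM sM).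
have lim_sqr e : Int (elen e) (fun x => phi k e x * phi k e x) @[k --> U] -->
    Int (elen e) (fun x => s e x * s e x).
  have [M2 sM] := bcont_closed_bound (bs e).
  apply: ucvg_Int; first exact: elen_gt0.
  - by move=> k; apply: bcontM => //; exact: gspace_bcont.
  - exact: bcontM.
  - exact: (ucvgM FU (us e) (us e) sM sM).
have lim_vertex v : vertex_sum v (phi k) @[k --> U] --> vertex_sum v s.
  by apply: cvg_bigsum => -[e t] _; apply: pt; case: t => /=; [exact: lle|exact: l0e].
pose B' f g := b f g + (- mu0) * ip f g.
have sB' : symform B' by apply: symform_comb; [exact: symform_delta|exact: symform_ip].
have B'ge0 f : Y f -> 0 <= B' f f.
  by move=> fY; have := rayleigh_inf_le e0 fY; rewrite /B'; lra.
(* Cauchy-Schwarz for [b - mu0 ip], which is nonnegative on [Y]: a minimizing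
   sequence satisfies the Euler-Lagrange equation in the limit. *)
have small (psi : gspace G) : B' (phi k) psi @[k --> U] --> 0.
  pose y := ortho_residual (@ip R G) o psi.
  have yY : Y y by exact: (ortho_residual_orth (@symform_ip R G) oo).
  (* Only the component of [psi] orthogonal to the [o i] matters: these are eigenfunctions, and
     [phi k] is orthogonal to them. *)
  have BE k : B' (phi k) psi = B' (phi k) y.
    rewrite [RHS]symformBr// symform_sumr// big1 ?subr0// => i _.
    rewrite symformZr// /B' (symform_delta beta bq).2 (eigenfunction_delta _ bq b0 (oe i)).
    by rewrite ((@symform_ip R G).2 (phi k)) phiY !mulr0 addr0 mulr0.
  have K0 := B'ge0 _ yY.
  have BS k : (B' (phi k) y) ^+ 2 <= k.+1%:R^-1 * B' y y.
    apply: (@le_trans _ _ (B' (phi k) (phi k) * B' y y)).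
      apply: symform_CS_on => // a; apply: B'ge0 => i.
      have sip := @symform_ip R G.
      by rewrite symformDr// symformZr// phiY yY mulr0 addr0.
    rewrite ler_wpM2r// /B' phi1 mulr1; by rewrite lerBlDl; exact: phib.
  apply/cvgrPdist_le => eps eps0; apply: subU.
  exists (Num.trunc (B' y y / eps ^+ 2)) => // k /= hk.
  rewrite sub0r normrN BE.
  have h : `|B' (phi k) y| ^+ 2 <= eps ^+ 2.
    rewrite real_normK ?num_real//; apply: le_trans (BS k) _.
    rewrite mulrC ler_pdivrMr// mulrC -ler_pdivrMr ?exprn_gt0//.
    by apply: le_trans (ltW (truncnS_gt _)) _; rewrite ler_nat.
  by move: h; rewrite ler_pXn2r// nnegrE ltW.
have weak (psi psi1 : gspace G) :
  (forall e x, 0 < x < elen e -> derive1 (psi e) x = psi1 e x) ->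
  \sum_e (psi1 e (elen e) * s e (elen e) - psi1 e 0 * s e 0 +
     Int (elen e) (fun x => (q e x * psi e x - derive1 (psi1 e) x) * s e x)) +
  beta^-1 * \sum_v vertex_sum v psi * vertex_sum v s =
  mu0 * \sum_e Int (elen e) (fun x => psi e x * s e x).
  move=> dpsi.
  pose L (f : edge G -> R -> R) :=
    \sum_e (psi1 e (elen e) * f e (elen e) - psi1 e 0 * f e 0 +
     Int (elen e) (fun x => (q e x * psi e x - derive1 (psi1 e) x) * f e x)) +
    beta^-1 * (\sum_v vertex_sum v psi * vertex_sum v f) -
    mu0 * \sum_e Int (elen e) (fun x => psi e x * f e x).
  have LB k : L (phi k) = B' (phi k) psi.
    rewrite sB'.2 /B' mulNr; congr (_ + _ - _).
    apply: eq_bigr => e _.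
    by rewrite (green (phi k) (dpsi e) (gspace_der psi1 e) (gspace_bcont1 psi1 e) bq).
  have Llim : L (phi k) @[k --> U] --> L s.
    rewrite /L; apply: cvgB.
      apply: cvgD.
        apply: cvg_bigsum => e _; apply: cvgD.
          by apply: cvgB; apply: cvgM; [exact: cvg_cst|exact: pt|exact: cvg_cst|exact: pt].
        apply: lim_Int; apply: bcontB.
          by apply: bcontM; [exact: bq|exact: gspace_bcont].
        exact: gspace_bcont1.
      apply: cvgM; first exact: cvg_cst.
      by apply: cvg_bigsum => v _; apply: cvgM; [exact: cvg_cst|exact: lim_vertex].
    apply: cvgM; first exact: cvg_cst.
    by apply: cvg_bigsum => e _; apply: lim_Int; exact: gspace_bcont.
  have L0 : L s = 0.
    have L0' : L (phi k) @[k --> U] --> 0.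
      have -> : (fun k => L (phi k)) = (fun k => B' (phi k) psi) by apply/funext.
      exact: small.
    exact: (@cvg_unique _ (@Rhausdorff R) _ _ _ _ Llim L0').
  by apply/eqP; rewrite -subr_eq0; apply/eqP.
have [u [ue us']] := weak_solution_regular bq b0 (@cs) weak.
have uE e x : 0 < x < elen e -> u e x = s e x.
  by move=> /andP[x0 xl]; apply: us'; rewrite !ltW.
exists u; split => // [i|].
  have -> : ip (o i) u = \sum_e Int (elen e) (fun x => o i e x * s e x).
    by apply: eq_bigr => e _; apply: eq_Int => x xl; rewrite uE.
  have c : ip (o i) (phi k) @[k --> U] --> \sum_e Int (elen e) (fun x => o i e x * s e x).
    by apply: cvg_bigsum => e _; apply: lim_Int; exact: gspace_bcont.
  have c' : ip (o i) (phi k) @[k --> U] --> (0 : R).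
    have -> : (fun k => ip (o i) (phi k)) = (fun=> 0) by apply/funext => k; exact: phiY.
    exact: cvg_cst.
  exact: (@cvg_unique _ (@Rhausdorff R) _ _ _ _ c c').
have -> : ip u u = \sum_e Int (elen e) (fun x => s e x * s e x).
  by apply: eq_bigr => e _; apply: eq_Int => x xl; rewrite uE.
have c : ip (phi k) (phi k) @[k --> U] --> \sum_e Int (elen e) (fun x => s e x * s e x).
  by apply: cvg_bigsum => e _; exact: lim_sqr.
have c' : ip (phi k) (phi k) @[k --> U] --> (1 : R).
  have -> : (fun k => ip (phi k) (phi k)) = (fun=> 1) by apply/funext.
  exact: cvg_cst.
exact: (@cvg_unique _ (@Rhausdorff R) _ _ _ _ c c').
Qed.

End minimization.

(** * Successive choice of eigenfunctions *)

Section eigensystem.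
Context (R : realType) (G : metric_graph R) (e0 : edge G) (q : edge G -> R -> R).
Hypothesis bq : bounded_potential q.
Context (beta : R) (b0 : 0 < beta).
Notation b := (delta_form q beta).
Notation x0 := ((0, 0) : R * gspace G).

Let fam (t : seq (R * gspace G)) (i : nat) := (nth x0 t i).2.

Let good (t : seq (R * gspace G)) : Prop :=
  (forall i j, (i < size t)%N -> (j < size t)%N -> ip (fam t i) (fam t j) = (i == j)%:R) /\
  (forall i, (i < size t)%N -> real_eigenfunction q beta (nth x0 t i).1 (fam t i)).

Let next (t : seq (R * gspace G)) (x : R * gspace G) : Prop :=
  [/\ real_eigenfunction q beta x.1 x.2,
      forall i, (i < size t)%N -> ip (fam t i) x.2 = 0,
      ip x.2 x.2 = 1 &
      forall f, (forall i, (i < size t)%N -> ip (fam t i) f = 0) -> x.1 * ip f f <= b f f].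

(** The premise [good t] stands under the existential so that the axiom of choice yields a total
    step function; on other lists the value is arbitrary. *)
Let next_exists t : exists x, good t -> next t x.
Proof.
have [[to te]|] := pselect (good t); last by exists x0.
pose o (i : 'I_(size t)) := fam t i.
have oo : orthonormal_family (@ip R G) o by move=> i j; exact: to.
have oe (i : 'I_(size t)) : real_eigenfunction q beta (nth x0 t i).1 (o i) by exact: te.
have [u [ue uY u1]] := rayleigh_minimizer bq b0 oo oe e0.
exists (inf [set b f f | f in [set f | (forall i, ip (o i) f = 0) /\ ip f f = 1]], u) => _.
split=> // [i it|f fY]; first exact: (uY (Ordinal it)).
by apply: (rayleigh_inf_le bq b0 (o := o)) => // i; exact: fY.
Qed.

Lemma eigensystem_exists : exists (mu : nat -> R) (g : nat -> gspace G),
  min_eigensystem (@ip R G) b mu g /\ forall k, real_eigenfunction q beta (mu k) (g k).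
Proof.
have /choice[step stepP] := next_exists.
(* Each pair depends on all earlier ones, so the recursion builds lists; by [nthF] an entry never
   changes once added. *)
pose F n := iter n (fun t => rcons t (step t)) [::].
have szF n : size (F n) = n by elim: n => //= n IH; rewrite size_rcons IH.
have nthF n i : (i < n)%N -> nth x0 (F n) i = step (F i).
  elim: n => // n IH; rewrite ltnS leq_eqVlt => /predU1P[->|lin].
    by rewrite /= nth_rcons szF ltnn eqxx.
  by rewrite /= nth_rcons szF lin IH.
have goodF n : good (F n).
  elim: n => [|n IH]; first by split.
  have [se so s1 _] := stepP _ IH; rewrite szF in so.
  have so' i : (i < n)%N -> ip (step (F i)).2 (step (F n)).2 = 0.
    by move=> lin; have := so i lin; rewrite /fam (nthF _ _ lin).
  have IH1 i j : (i < n)%N -> (j < n)%N -> ip (step (F i)).2 (step (F j)).2 = (i == j)%:R.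
    by move=> lin ljn; have := IH.1 i j; rewrite szF /fam (nthF _ _ lin) (nthF _ _ ljn); apply.
  have IH2 i : (i < n)%N -> real_eigenfunction q beta (step (F i)).1 (step (F i)).2.
    by move=> lin; have := IH.2 i; rewrite szF /fam (nthF _ _ lin); apply.
  split => [i j|i]; rewrite szF => lin.
    move=> ljn; rewrite /fam (nthF _ _ lin) (nthF _ _ ljn); move: lin ljn.
    rewrite !ltnS leq_eqVlt => /predU1P[->|lin]; rewrite leq_eqVlt => /predU1P[->|ljn].
    - by rewrite s1 eqxx.
    - by rewrite (@symform_ip R G).2 so'// gtn_eqF.
    - by rewrite so'// ltn_eqF.
    - exact: IH1.
  rewrite /fam (nthF _ _ lin); move: lin; rewrite ltnS leq_eqVlt => /predU1P[->//|].
  exact: IH2.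
pose mu n := (step (F n)).1; pose g n := (step (F n)).2.
have nextF n : next (F n) (step (F n)) by exact: stepP.
have ge k : real_eigenfunction q beta (mu k) (g k) by case: (nextF k).
have gg i j : ip (g i) (g j) = (i == j)%:R.
  have im : (i < (maxn i j).+1)%N by rewrite ltnS leq_maxl.
  have jm : (j < (maxn i j).+1)%N by rewrite ltnS leq_maxr.
  have := (goodF (maxn i j).+1).1 i j; rewrite szF => /(_ im jm).
  by rewrite /fam (nthF _ _ im) (nthF _ _ jm).
have gmin K f : (forall k, (k < K)%N -> ip (g k) f = 0) -> mu K * ip f f <= b f f.
  move=> h; case: (nextF K) => _ _ _; apply=> i; rewrite szF => iK.
  by rewrite /fam (nthF _ _ iK); exact: h.
exists mu, g; split => //; split => //; last first.
  by move=> k h; exact: eigenfunction_delta.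
apply: (@homo_leq _ _ <=%O) => [x|x y z|k]; [exact: lexx|exact: le_trans|].
(* Monotonicity: [g k.+1] is a competitor in the [k]-th minimization. *)
have := gmin k (g k.+1); rewrite gg eqxx mulr1 (eigenfunction_delta _ bq b0 (ge _)) gg eqxx mulr1.
by apply => i ik; rewrite gg ltn_eqF// ltnW.
Qed.

End eigensystem.

(** * Superlinear gap for the delta' form *)

Lemma has_deriv_exp (R : realType) (l : R) (l0 : 0 < l) (f f1 : R -> R) n :
  has_deriv l f f1 -> has_deriv l (fun x => f x ^+ n.+1) (fun x => n.+1%:R * f x ^+ n * f1 x).
Proof.
move=> df; elim: n => [|n IH].
  apply: has_deriv_eq (_ : has_deriv l (fun x => f x ^+ 1) f1) => [x _|].
    by rewrite expr0 !mul1r.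
  by under eq_fun do rewrite expr1.
have := has_derivM df IH.
under eq_fun do rewrite -exprS.
apply: has_deriv_eq => x _; rewrite -[n.+2%:R]natr1 [in RHS]exprS exprS; ring.
Qed.

Lemma Int_sum (R : realType) (l : R) (l0 : 0 < l) (I : Type) (r : seq I) (F : I -> R -> R) :
  (forall i, bcont l (F i)) ->
  bcont l (fun x => \sum_(i <- r) F i x) /\
  Int l (fun x => \sum_(i <- r) F i x) = \sum_(i <- r) Int l (F i).
Proof.
move=> bF; elim: r => [|i r [IH1 IH2]].
  have -> : (fun x => \sum_(i <- [::]) F i x) = fun=> 0 by apply/funext => x; rewrite big_nil.
  by rewrite big_nil Int_cst// mul0r; split=> //; exact: bcont_cst.
have -> : (fun x => \sum_(j <- i :: r) F j x) = fun x => F i x + \sum_(j <- r) F j x.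
  by apply/funext => x; rewrite big_cons.
by rewrite big_cons -IH2 IntD//; split=> //; exact: bcontD.
Qed.

Section gap.
Context (R : realType) (G : metric_graph R) (e0 : edge G) (q : edge G -> R -> R).
Hypothesis bq : bounded_potential q.
Context (beta : R) (b0 : 0 < beta).
Notation b := (delta_form q beta).
Context (mu : nat -> R) (g : nat -> gspace G).
Hypothesis gsys : min_eigensystem (@ip R G) b mu g.

Lemma vertex_sum_unbounded (x : R) :
  exists f : gspace G, x * ip f f < (vertex_sum (src e0) f) ^+ 2.
Proof.
have l0 := elen_gt0 e0; set l := elen e0 in l0 *.
(* Chosen against the squared norm [l / (2 * n + 3)] of the test function below, whose value at the
   source is 1. *)
pose n := (Num.trunc (`|x| * l)).+1.
have dw : has_deriv l (fun t => 1 + (- l^-1) * t) (fun=> - l^-1).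
  apply: has_deriv_eq (has_derivD (has_deriv_cst _ 1)
    (has_derivZ (- l^-1) (has_deriv_id l))) => t _.
  by rewrite add0r mulr1.
(* Concentrates at the source of [e0] and vanishes at its other end. *)
pose w t := (1 + (- l^-1) * t) ^+ n.+1.
have dwn := has_deriv_exp l0 n dw.
have bw := has_deriv_bcont l0 dw.
have bwp k : bcont l (fun t => (1 + (- l^-1) * t) ^+ k).
  case: k => [|k]; first by under eq_fun do rewrite expr0; exact: bcont_cst.
  exact: has_deriv_bcont (has_deriv_exp l0 k dw).
have bdw : bcont l (fun t => n.+1%:R * (1 + - l^-1 * t) ^+ n * - l^-1).
  by apply: bcontM (bcont_cst _ _); apply: bcontZ.
have [f fE] := single_edge_fun dwn bdw.
have w0 : w 0 = 1 by rewrite /w mulr0 addr0 expr1n.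
have wl : w l = 0 by rewrite /w mulNr mulVf ?gt_eqF// subrr expr0n.
exists f.
have -> : vertex_sum (src e0) f = 1.
  rewrite /vertex_sum (bigD1 (e0, false))//= big1 ?addr0.
    by rewrite /end_val/= fE eqxx.
  (* When [e0] is a loop its other end belongs to the same vertex, and [wl] makes that end
     contribute nothing. *)
  move=> [e t] /andP[_ et]; rewrite /end_val/= fE.
  case: eqP => // ee; move: et; rewrite ee xpair_eqE eqxx/=; case: t => //= _.
rewrite expr1n.
have -> : ip f f = l / (2 * n + 3)%:R.
  rewrite /ip (bigD1 e0)//= big1 ?addr0; last first.
    move=> e ee; rewrite (eq_Int (h := fun=> 0)) ?Int_cst ?mul0r ?elen_gt0// => t _.
    by rewrite fE (negbTE ee) mul0r.
  have dW := has_derivZ (- l / (2 * n + 3)%:R) (has_deriv_exp l0 (2 * n + 2) dw).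
  have E t : 0 < t < l -> - l / (2 * n + 3)%:R *
      ((2 * n + 2).+1%:R * (1 + - l^-1 * t) ^+ (2 * n + 2) * - l^-1) =
      f e0 t * f e0 t.
    move=> _; rewrite fE eqxx -exprD.
    have -> : (n.+1 + n.+1 = 2 * n + 2)%N by rewrite mul2n -addnn addnS addSn addn2.
    rewrite -[(2 * n + 2).+1]/(2 * n + 2).+1 addnS.
    by field; rewrite gt_eqF//= pnatr_eq0.
  rewrite -(eq_Int E) (FTC l0 _ dW).
    have E0 : 1 + - l^-1 * 0 = 1 by rewrite mulr0 addr0.
    have El : 1 + - l^-1 * l = 0 by rewrite mulNr mulVf ?gt_eqF// subrr.
    rewrite E0 El expr1n expr0n/=; ring.
  by apply: bcontZ; apply: bcontM (bcont_cst _ _); apply: bcontZ.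
apply: le_lt_trans (_ : `|x| * (l / (2 * n + 3)%:R) < 1).
  by rewrite ler_wpM2r ?ler_norm// divr_ge0// ltW.
rewrite mulrA ltr_pdivrMr ?ltr0n// mul1r.
apply: lt_le_trans (truncnS_gt _) _; rewrite ler_nat -/n.
by rewrite mul2n -addnn -addnA leq_addr.
Qed.

Let M : R := xget 0 [set M | 0 <= M /\ forall e x, 0 < x < elen e -> `|q e x| <= M].

Let MP : 0 <= M /\ forall e x, 0 < x < elen e -> `|q e x| <= M.
Proof.
have [M' M0 qM] := potential_bound bq.
exact: (@xgetPex _ (0 : R)
  [set M | 0 <= M /\ forall e x, 0 < x < elen e -> `|q e x| <= M]
  (ex_intro _ M' (conj M0 qM))).
Qed.

(** The shift keeps the eigenvectors. Its part [M] compensates for the potential, and the extra 1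
    makes [b'] dominate [ip], so that the shifted eigenvalues are at least 1. *)
Let b' (f h : gspace G) := b f h + (M + 1) * ip f h.
Let mu' k := mu k + (M + 1).

Let sip := @symform_ip R G.
Let sb' : symform b'.
Proof. by apply: symform_comb => //; exact: symform_delta. Qed.

Let dir_b' f : dirichlet f + ip f f <= b' f f.
Proof. by have := delta_form_ge bq b0 f MP.2; rewrite /b'; lra. Qed.

Let gsys' : min_eigensystem (@ip R G) b' mu' g.
Proof.
case: gsys => mono on eig gmin; split.
- by move=> m n /mono; rewrite /mu' lerD2r.
- exact: on.
- by move=> k h; rewrite /b' eig /mu'; ring.
- by move=> K f /gmin; rewrite /b' /mu'; lra.
Qed.

Let mu'_ge1 k : 1 <= mu' k.
Proof.
case: gsys' => _ on eig _.
have := dir_b' (g k); rewrite eig on eqxx mulr1 /=; have := dirichlet_ge0 (g k); lra.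
Qed.

Let C0 := sobolev_const G.
Let C0_gt0 : 0 < C0. Proof. exact: sobolev_const_gt0. Qed.

Let sob eps f : 0 < eps -> eps * dirichlet f + eps^-1 * ip f f <= eps * b' f f + eps^-1 * ip f f.
Proof.
move=> e1; rewrite lerD2r ler_pM2l//; apply: le_trans _ (dir_b' f).
by rewrite lerDl ip_ge0.
Qed.

(** Taking point evaluation as the functional bounds the sum of the [g k e x ^+ 2], [k <= N], by
    [2 * C0 * sqrt (mu' N)]. Integration over the graph, of total length [L], turns the left side
    into [N.+1]. *)
Let weyl : exists2 c : R, 0 < c & forall N, c * N%:R <= Num.sqrt (mu' N).
Proof.
pose L := \sum_(e : edge G) elen e.
have L0 : 0 < L.
  rewrite /L (bigD1 e0)//=; apply: ltr_wpDr; last exact: elen_gt0.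
  by apply: sumr_ge0 => e _; rewrite ltW ?elen_gt0.
exists (2 * C0 * L)^-1; first by rewrite invr_gt0 !mulr_gt0.
move=> N; rewrite mulrC ler_pdivrMr ?mulr_gt0//.
have pointwise e x : 0 < x < elen e ->
    \sum_(k < N.+1) g k e x * g k e x <= 2 * C0 * Num.sqrt (mu' N).
  move=> /andP[x0 xl].
  have := @boundary_mass_le R _ (@ip R G) b' sip sb' mu' g gsys' mu'_ge1
    (fun f => f e x) C0 C0_gt0 (fun a f h => gspaceE a f h e x) _ N.
  rewrite /boundary_mass => H.
  under eq_bigr do rewrite -expr2; apply: H => eps f e1 e2.
  apply: le_trans (point_sobolev f e1 e2 _) _; first by rewrite !ltW.
  by rewrite ler_pM2l//; exact: sob.
have bk e (k : 'I_N.+1) : bcont (elen e) (fun x => g k e x * g k e x).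
  by apply: bcontM; exact: gspace_bcont.
have : (N.+1%:R : R) <= \sum_(e : edge G) (2 * C0 * Num.sqrt (mu' N) * elen e).
  have -> : (N.+1%:R : R) =
      \sum_(e : edge G) Int (elen e) (fun x => \sum_(k < N.+1) g k e x * g k e x).
    rewrite (eq_bigr (fun e =>
      \sum_(k < N.+1) Int (elen e) (fun x => g k e x * g k e x))); last first.
      by move=> e _; rewrite (Int_sum (elen_gt0 e) _ (bk e)).2.
    rewrite exchange_big/= (eq_bigr (fun=> 1)) ?sumr_const ?card_ord// => k _.
    by case: gsys => _ on _ _; have := on k k; rewrite eqxx.
  apply: ler_sum => e _; rewrite -(Int_cst (elen_gt0 e)).
  apply: (Int_le (elen_gt0 e)); [exact: (Int_sum (elen_gt0 e) _ (bk e)).1|exact: bcont_cst|].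
  exact: pointwise.
rewrite -mulr_sumr -/L -natr1.
have -> : Num.sqrt (mu' N) * (2 * C0 * L) = 2 * C0 * Num.sqrt (mu' N) * L by ring.
lra.
Qed.

(** The vertex sum at the single vertex [src e0] already gives the superlinear gap; its vanishing at
    all vertices reduces the [delta'] form of [f n] to the energy. The shift by [M + 1] adds the
    same amount on both sides. *)
Lemma delta_trace_gap x : exists N0, forall N (f : 'I_N -> gspace G), (N0 <= N)%N ->
  orthonormal_family (@ip R G) f -> (forall n v, vertex_sum v (f n) = 0) ->
  \sum_(k < N) mu k + x * N%:R <= \sum_n energy q (f n) (f n).
Proof.
have [c c0 cw] := weyl.
pose v := src e0.
pose C := #|{: edge_end G}|%:R ^+ 2 * C0.
have C_gt0 : 0 < C.
  rewrite mulr_gt0// exprn_gt0// ltr0n; apply/card_gt0P.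
  by exists (e0, true).
have sobv eps (f : gspace G) : 0 < eps -> eps <= 1 ->
    (vertex_sum v f) ^+ 2 <= C * (eps * b' f f + eps^-1 * ip f f).
  move=> e1 e2; apply: le_trans (vertex_sobolev v f e1 e2) _.
  by rewrite -/C0 -/C ler_pM2l//; exact: sob.
have [N0 hN0] := @trace_gap_superlinear R _ (@ip R G) b' sip sb' (@ip_ge0 R G) mu' g gsys' mu'_ge1
  (vertex_sum v) C C_gt0 (@vertex_sum_lin R G v) sobv vertex_sum_unbounded c c0 cw x.
exists N0 => N f N0N fo fv.
have := hN0 N f N0N fo (fun n => fv n v).
have -> : \sum_(k < N) mu' k = \sum_(k < N) mu k + (M + 1) * N%:R.
  by rewrite big_split/= sumr_const card_ord mulr_natr.
have -> : \sum_n b' (f n) (f n) = \sum_n energy q (f n) (f n) + (M + 1) * N%:R.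
  have -> : (M + 1) * N%:R = \sum_(n < N) (M + 1) by rewrite sumr_const card_ord mulr_natr.
  rewrite -big_split; apply: eq_bigr => n _ /=.
  rewrite /b' /delta_form fo eqxx mulr1; congr (_ + _).
  by rewrite /vertex_form big1 ?mulr0 ?addr0// => u _; rewrite fv mul0r.
lra.
Qed.

End gap.

(** * From complex to real eigenfunctions *)

Section potentials.
Context (R : realType) (G : metric_graph R).
Notation leb := (@lebesgue_measure R).

(** A violation at one point persists on a ball, which has positive measure. *)
Lemma ae_bounded_continuous (l M : R) (h : R -> R) :
  (forall x, 0 < x < l -> {for x, continuous h}) ->
  (\forall x \ae leb, 0 < x < l -> `|h x| <= M) ->
  forall x, 0 < x < l -> `|h x| <= M.
Proof.
move=> ch [N [mN N0 subN]] x xl; rewrite leNgt; apply/negP => hx.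
have cn : {for x, continuous (fun y => `|h y|)}.
  by apply: (@continuous_comp _ _ _ h (fun z => `|z|)); [exact: ch|exact: norm_continuous].
have near1 : \forall y \near x, M < `|h y|.
  by apply: (@cvgr_gt R _ (nbhs x) _ (fun y => `|h y|) _ cn).
have near2 : \forall y \near x, 0 < y < l by exact: near_open.
have [e /= e0 eb] : nbhs x (fun y => M < `|h y| /\ 0 < y < l).
  by apply: filterS2 near1 near2 => y.
have bN : ball x e `<=` N.
  move=> y xy; apply: subN => /= H.
  have [h1 h2] := eb y xy.
  by have := H h2; rewrite leNgt h1.
have : (leb (ball x e) <= leb N)%E.
  apply: le_measure => //; rewrite inE//; exact: measurable_ball.
rewrite N0 lebesgue_measure_ball; last exact: ltW.
by rewrite leNgt lte_fin mulrn_wgt0.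
Qed.

Lemma smooth_bounded_bcont (q : edge G -> R -> R) :
  smooth_bounded_potential q -> bounded_potential q.
Proof.
move=> sq e; have [dq [M qM]] := sq e.
have cq x : 0 < x < elen e -> {for x, continuous (q e)}.
  move=> xl; have d : derivable (q e) x 1 by exact: (dq 0%N).
  by apply: differentiable_continuous; apply/derivable1_diffP.
split=> //; exists M; exact: ae_bounded_continuous.
Qed.

End potentials.

Section eigenfunction_parts.
Context (R : realType) (G : metric_graph R).
Notation leb := (@lebesgue_measure R).

Lemma is_L2_integrable (l : R) (u : R -> R[i]) : 0 < l -> is_L2 l u ->
  leb.-integrable `]0, l[ (EFin \o (fun x => complex.Re (u x))) /\
  leb.-integrable `]0, l[ (EFin \o (fun x => complex.Im (u x))).
Proof.
move=> l0 [mR mI iu].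
have i1 : leb.-integrable `]0, l[
    (fun x => (1 + (complex.Re (u x) ^+ 2 + complex.Im (u x) ^+ 2))%:E).
  have i0 : leb.-integrable `]0, l[ (EFin \o (fun=> 1)).
    exact: (bcont_integrable l0 (bcont_cst l 1)).
  exact: (integrableD _ i0 iu).
have H (a c : R) : (`|a%:E| <= `|(1 + (a ^+ 2 + c ^+ 2))%:E|)%E.
  rewrite !abse_EFin lee_fin [leRHS]ger0_norm; last by rewrite !addr_ge0 ?sqr_ge0.
  have : 0 <= (`|a| - 1) ^+ 2 by exact: sqr_ge0.
  have := sqr_ge0 c; rewrite -(real_normK (num_real a)) !expr2.
  have := normr_ge0 a; nra.
split; apply: le_integrable i1 => //.
- exact/measurable_EFinP.
- by move=> x _; exact: H.
- exact/measurable_EFinP.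
- by move=> x _; rewrite [(_ ^+ 2 + _)%R]addrC; exact: H.
Qed.

(* [pr] stands for [Re] or [Im]. *)
Lemma eigenfunction_part (q : edge G -> R -> R) (beta mu : R) (f : gfun G)
    (pr : R[i] -> R) :
  bounded_potential q ->
  (forall z w, pr (z + w) = pr z + pr w) -> (forall z, pr (- z) = - pr z) ->
  (forall (a : R) z, pr (a%:C * z) = a * pr z) ->
  (forall (A : set R) h, pr (Cintegral A h) = \int[leb]_(x in A) pr (h x)) ->
  (forall l h, 0 < l -> is_L2 l h -> leb.-integrable `]0, l[ (EFin \o (fun x => pr (h x)))) ->
  eigenspace q (fun=> beta) mu f ->
  exists u : gspace G, real_eigenfunction q beta mu u /\
    forall e x, u e x = pr (f e x).
Proof.
move=> bq prD prN prZ prI prL [f1 [f2 [H2 dp ev]]].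
pose u e x := pr (f e x); pose u1 e x := pr (f1 e x); pose u2 e x := pr (f2 e x).
pose p e x := (q e x - mu) * u e x.
have i1 e : leb.-integrable `]0, elen e[ (EFin \o u1 e).
  by case: (H2 e) => -[+ _] _; apply: prL; exact: elen_gt0.
have i2 e : leb.-integrable `]0, elen e[ (EFin \o u2 e).
  by case: (H2 e) => _ [+ _]; apply: prL; exact: elen_gt0.
have uE e x : 0 <= x <= elen e -> u e x = u e 0 + prim (elen e) (u1 e) x.
  move=> xl; rewrite (prim_integral (i1 e) xl) -prI -prD.
  by case: (H2 e) => -[_ /(_ x xl) E] _; rewrite /u [in LHS]E.
have u1E e x : 0 <= x <= elen e -> u1 e x = u1 e 0 + prim (elen e) (u2 e) x.
  move=> xl; rewrite (prim_integral (i2 e) xl) -prI -prD.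
  by case: (H2 e) => _ [_ /(_ x xl) E]; rewrite /u1 [in LHS]E.
have cont (l : R) (v h : R -> R) : 0 < l -> leb.-integrable `]0, l[ (EFin \o h) ->
    (forall x, 0 <= x <= l -> v x = v 0 + prim l h x) -> {within `[0, l], continuous v}.
  move=> l0 ih vE.
  have c : {within `[0, l], continuous (fun x => v 0 + prim l h x)}.
    apply: (@within_continuousD _ _ _ _ (fun=> v 0)); last exact: (prim_continuous l0 ih).
    by move=> x; exact: cst_continuous.
  by apply: subspace_eq_continuous c => x; rewrite inE/= in_itv/= => xl; exact/esym/vE.
have cu e : {within `[0, elen e], continuous (u e)}.
  exact: (cont _ _ _ (elen_gt0 e) (i1 e) (uE e)).
have cu1 e : {within `[0, elen e], continuous (u1 e)}.
  exact: (cont _ _ _ (elen_gt0 e) (i2 e) (u1E e)).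
have bu e : bcont (elen e) (u e) by exact: (within_bcont (elen_gt0 e) (@cu e)).
have bu1 e : bcont (elen e) (u1 e) by exact: (within_bcont (elen_gt0 e) (@cu1 e)).
have bp e : bcont (elen e) (p e).
  by apply: bcontM => //; apply: bcontB (bcont_cst _ _); exact: bq.
have du e : has_deriv (elen e) (u e) (u1 e).
  have l0 := elen_gt0 e.
  apply: (@has_deriv_eqf _ _ (fun x => u e 0 + prim (elen e) (u1 e) x)).
    by move=> x xl; rewrite -uE.
  apply: has_deriv_eq (has_derivD (has_deriv_cst _ _) (prim_has_deriv l0 (bu1 e))) => x _.
  by rewrite add0r.
(* [u2] is only square integrable, but the eigenvalue equation identifies it almost everywhere with
   the continuous [p]. Their primitives agree, so [u1] is differentiable at every interior point. *)
have u2p e x : 0 <= x <= elen e -> prim (elen e) (u2 e) x = prim (elen e) (p e) x.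
  move=> xl; have ip := bcont_integrable (elen_gt0 e) (bp e).
  rewrite (prim_integral (i2 e) xl) (prim_integral ip xl) /Rintegral; congr fine.
  have /andP[_ xl'] := xl.
  have sub : `]0, x[%classic `<=` `]0, elen e[%classic by exact: subset_itvl.
  have meas h : leb.-integrable `]0, elen e[ (EFin \o h) -> measurable_fun `]0, x[ (EFin \o h).
    move=> ih; have ih' : leb.-integrable `]0, x[ (EFin \o h) by exact: integrableS ih.
    exact: measurable_int ih'.
  apply: ae_eq_integral => //; [exact: (meas _ (i2 e))|exact: (meas _ ip)|].
  move: (ev e); apply: filterS; first exact: (ae_filter_ringOfSetsType leb).
  move=> t H /= t0x.
  have {H} := congr1 pr (H (sub _ t0x)); rewrite prZ prD prN prZ => H.
  by congr EFin; rewrite /p /u2 /u; lra.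
have du1 e : has_deriv (elen e) (u1 e) (p e).
  have l0 := elen_gt0 e.
  apply: (@has_deriv_eqf _ _ (fun x => u1 e 0 + prim (elen e) (p e) x)).
    by move=> x xl; rewrite -u2p// -u1E.
  apply: has_deriv_eq (has_derivD (has_deriv_cst _ _) (prim_has_deriv l0 (bp e))) => x _.
  by rewrite add0r.
have ru : u \in @regular_pred R G by apply/asboolP => e; exists (u1 e).
have ru1 : u1 \in @regular_pred R G by apply/asboolP => e; exists (p e).
exists (GSpace ru); split=> //; exists (GSpace ru1); split.
- by move=> e x xl; exact: (has_deriv_der (du e) xl).
- by move=> e x xl; exact: (has_deriv_der (du1 e) xl).
- move=> v; have [d [dpe dS]] := dp v; exists (pr d); split.
    move=> [e t] ev'; rewrite -(dpe _ ev') /end_slope /end_deriv.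
    by case: t ev' => //= _; rewrite prN.
  rewrite -prZ -dS.
  have prsum (I : finType) (P : pred I) (F : I -> R[i]) :
      pr (\sum_(i | P i) F i) = \sum_(i | P i) pr (F i).
    apply: (big_morph pr prD).
    by have := prZ 0 0; rewrite mulr0 mul0r.
  by rewrite prsum.
Qed.

(** The potential, the coupling and the eigenvalue are real, so real and imaginary parts satisfy the
    same conditions separately. *)
Lemma eigenfunction_Re_Im (q : edge G -> R -> R) (beta mu : R) (f : gfun G) :
  bounded_potential q -> eigenspace q (fun=> beta) mu f ->
  exists u w : gspace G, [/\ real_eigenfunction q beta mu u,
    real_eigenfunction q beta mu w & forall e x, f e x = u e x +i* w e x].
Proof.
move=> bq ef.
have [u [ru uE]] : exists u : gspace G, real_eigenfunction q beta mu u /\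
    forall e x, u e x = complex.Re (f e x).
  apply: eigenfunction_part ef => //.
  - by case=> ? ? [].
  - by case.
  - by move=> a [z1 z2] /=; rewrite mul0r subr0.
  - by move=> l h l0 hh; have [] := is_L2_integrable l0 hh.
have [w [rw wE]] : exists u : gspace G, real_eigenfunction q beta mu u /\
    forall e x, u e x = complex.Im (f e x).
  apply: eigenfunction_part ef => //.
  - by case=> ? ? [].
  - by case.
  - by move=> a [z1 z2] /=; rewrite mul0r addr0.
  - by move=> l h l0 hh; have [] := is_L2_integrable l0 hh.
exists u, w; split=> // e x; rewrite uE wE; by case: (f e x).
Qed.

Lemma real_eigenfunction_complex (q : edge G -> R -> R) (beta mu : R) (u : gspace G) :
  bounded_potential q -> real_eigenfunction q beta mu u ->
  eigenspace q (fun=> beta) mu (fun e x => (u e x)%:C).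
Proof.
move=> bq [u1 [uu1 u1u2 uv]].
pose p e x := (q e x - mu) * u e x.
have bp e : bcont (elen e) (p e).
  apply: bcontM; last exact: gspace_bcont.
  by apply: bcontB (bcont_cst _ _); exact: bq.
have du e : has_deriv (elen e) (u e) (u1 e).
  by apply: has_deriv_eq (gspace_der u e); exact: uu1.
have du1 e : has_deriv (elen e) (u1 e) (p e).
  by apply: has_deriv_eq (gspace_der u1 e); exact: u1u2.
have H1 e (v v' : R -> R) : has_deriv (elen e) v v' -> bcont (elen e) v' ->
    H1_deriv (elen e) (fun x => (v x)%:C) (fun x => (v' x)%:C).
  move=> dv bv; have l0 := elen_gt0 e; split; first split => /=.
  - exact: bcont_measurable.
  - exact: measurable_cst.
  - have := bcont_integrable l0 (bcontM bv bv).
    by congr (_.-integrable _ _); apply/funext => x /=; rewrite expr0n/= addr0 expr2.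
  move=> x xl; rewrite /Cintegral/= (FTC_x l0 bv dv xl).
  have -> : \int[leb]_(x0 in `]0, x[) (0 : R) = 0.
    by rewrite /Rintegral integral0.
  by apply/eqP; rewrite eq_complex /= addr0 !eqxx.
exists (fun e x => (u1 e x)%:C), (fun e x => (p e x)%:C); split.
- by move=> e; split; apply: H1 => //; exact: gspace_bcont.
- move=> v; have [d [dd dS]] := uv v; exists d%:C; split.
    move=> [e t] ev; rewrite -(dd _ ev) /end_slope /end_deriv /=.
    by case: t ev => //= _; rewrite rmorphN.
  rewrite -rmorphM/= -dS /vertex_sum rmorph_sum/=.
  by apply: eq_bigr => -[].
- move=> e; apply: aeW => x /= _.
  rewrite -!rmorphM -rmorphN -rmorphD/=; congr (_ +i* _).
  by rewrite /p; ring.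
Qed.

End eigenfunction_parts.

(** * Multiplicities *)

Section dimension.
Context (R : realType) (G : metric_graph R).
Notation leb := (@lebesgue_measure R).

Lemma gspace_sumE (I : finType) (c : I -> R) (F : I -> gspace G) e x :
  (\sum_i c i *: F i) e x = \sum_i c i * F i e x.
Proof. by elim/big_rec2: _ => [//|i y u _ <-]; rewrite gspaceE. Qed.

Lemma complex_sum (I : finType) (a c v : I -> R) :
  (\sum_i a i * v i) +i* (\sum_i c i * v i) = \sum_i (a i +i* c i) * (v i)%:C.
Proof.
elim/big_rec3: _ => [//|i z y x _ <-].
by apply/eqP; rewrite eq_complex/= !mulr0 subr0 add0r !eqxx.
Qed.

Lemma has_dim_independent (W : set (gfun G)) (k m : nat) (E : 'I_m -> gfun G) :
  has_dim W k -> (forall i, W (E i)) ->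
  (forall c, eq_L2 (lin_comb c E) (fun _ _ => 0) -> forall i, c i = 0) -> (m <= k)%N.
Proof.
move=> [F [FW _ Fspan]] EW Efree; rewrite leqNgt; apply/negP => km.
have /choice[C CE] : forall i, exists c, eq_L2 (E i) (lin_comb c F).
  by move=> i; exact: Fspan.
have [d d0 dC] := left_kernel_vector (\matrix_(i < m, j < k) C i j) km.
case/eqP: d0; apply/rowP => i; rewrite mxE.
apply: (Efree (fun i => d 0 i)) => e.
have : \forall x \ae leb, forall i, `]0, elen e[%classic x -> E i e x = lin_comb (C i) F e x.
  by apply: filter_forall => j; exact: CE.
apply: filterS; first exact: (ae_filter_ringOfSetsType leb).
move=> x Hx xl; rewrite /lin_comb.
rewrite (eq_bigr (fun i => \sum_j d 0 i * (C i j * F j e x))); last first.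
  by move=> j _; rewrite (Hx j xl) /lin_comb mulr_sumr.
rewrite exchange_big big1// => j _.
have /matrixP/(_ 0 j) := dC; rewrite !mxE => h.
rewrite (eq_bigr (fun i => d 0 i * C i j * F j e x)); last by move=> ? _; rewrite mulrA.
rewrite -mulr_suml -[RHS](mul0r (F j e x)); congr (_ * _).
by rewrite -[RHS]h; apply: eq_bigr => ? _; rewrite mxE.
Qed.

Lemma orthonormal_independent (m : nat) (o : 'I_m -> gspace G) (c : 'I_m -> R[i]) :
  orthonormal_family (@ip R G) o ->
  eq_L2 (lin_comb c (fun i e x => (o i e x)%:C)) (fun _ _ => 0) -> forall i, c i = 0.
Proof.
move=> oo H.
have part (a : 'I_m -> R) :
    (forall e, \forall x \ae leb, 0 < x < elen e -> \sum_i a i * o i e x = 0) ->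
    forall i, a i = 0.
  move=> a0 i; pose h : gspace G := \sum_i a i *: o i.
  rewrite -(sum_orthonormal (@symform_ip R G) oo a i) -/h /ip big1// => e _.
  have h0 x : 0 < x < elen e -> h e x = 0.
    move=> xl; apply/eqP; rewrite -normr_le0.
    apply: (@ae_bounded_continuous _ (elen e) 0 (h e)) => //.
      by case: (gspace_bcont h e).
    move: (a0 e); apply: filterS; first exact: (ae_filter_ringOfSetsType leb).
    by move=> y Hy yl; rewrite /h gspace_sumE Hy// normr0.
  rewrite (eq_Int (h := fun=> 0)); first by rewrite Int_cst ?mul0r ?elen_gt0.
  by move=> x xl; rewrite h0// mulr0.
have cE i : c i = complex.Re (c i) +i* complex.Im (c i) by case: (c i).
have comb e x : lin_comb c (fun i e x => (o i e x)%:C) e x =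
    (\sum_i complex.Re (c i) * o i e x) +i* (\sum_i complex.Im (c i) * o i e x).
  by rewrite complex_sum; apply: eq_bigr => i _; rewrite -cE.
have re0 : forall i, complex.Re (c i) = 0.
  apply: part => e; move: (H e); apply: filterS; first exact: (ae_filter_ringOfSetsType leb).
  by move=> x Hx xl; have := Hx; rewrite /= in_itv/= => /(_ xl); rewrite comb => -[].
have im0 : forall i, complex.Im (c i) = 0.
  apply: part => e; move: (H e); apply: filterS; first exact: (ae_filter_ringOfSetsType leb).
  by move=> x Hx xl; have := Hx; rewrite /= in_itv/= => /(_ xl); rewrite comb => -[].
by move=> i; rewrite cE re0 im0.
Qed.

Context (q : edge G -> R -> R) (beta : R).
Hypotheses (bq : bounded_potential q) (b0 : 0 <= beta).

(** Gram-Schmidt on the real and imaginary parts of a complex basis yields [r] real orthonormal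
    eigenfunctions. The [k] basis elements are complex combinations of these, so [r < k] would make
    them dependent; any [k] of the [r] will do. *)
Lemma eigenspace_orthonormal (mu : R) (k : nat) :
  has_dim (eigenspace q (fun=> beta) mu) k ->
  exists o : 'I_k -> gspace G, orthonormal_family (@ip R G) o /\
    forall i, real_eigenfunction q beta mu (o i).
Proof.
move=> [F [FW Ffree _]].
have /choice[p pP] : forall i, exists p : gspace G * gspace G,
    [/\ real_eigenfunction q beta mu p.1, real_eigenfunction q beta mu p.2 &
        forall e x, F i e x = p.1 e x +i* p.2 e x].
  by move=> i; have [u [w [h1 h2 h3]]] := eigenfunction_Re_Im bq (FW i); exists (u, w).
pose hs := [seq (p i).1 | i <- enum 'I_k] ++ [seq (p i).2 | i <- enum 'I_k].
have hs1 i : (p i).1 \in hs.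
  by rewrite mem_cat; apply/orP; left; apply/mapP; exists i; rewrite ?mem_enum.
have hs2 i : (p i).2 \in hs.
  by rewrite mem_cat; apply/orP; right; apply/mapP; exists i; rewrite ?mem_enum.
have hsP h : h \in hs -> real_eigenfunction q beta mu h.
  by rewrite mem_cat => /orP[] /mapP[i _ ->]; case: (pP i).
have [r [+ [+ + +]]] := gram_schmidt (@symform_ip R G) (@ip_ge0 R G)
  (@real_eigenfunction_lin R G q beta mu) (@real_eigenfunction0 R G q beta mu) hsP.
move=> o oo Po ho.
have span h : h \in hs -> forall e x, 0 < x < elen e -> h e x = \sum_j ip (o j) h * o j e x.
  move=> /ho hh e x xl.
  have /ip_eq0/(_ e x xl) : ip (ortho_residual (@ip R G) o h) (ortho_residual (@ip R G) o h) = 0.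
    apply: (@addrI _ (\sum_i ip (o i) h ^+ 2)).
    by rewrite -(sqr_residual (@symform_ip R G) oo) addr0.
  have -> : ortho_residual (@ip R G) o h e x = h e x - (\sum_i ip (o i) h *: o i) e x by [].
  by rewrite gspace_sumE => /eqP; rewrite subr_eq0 => /eqP.
have [kr|rk] := leqP k r.
  exists (o \o widen_ord kr); split=> [i j|i]; last exact: Po.
  by rewrite /= oo.
have [c c0 cA] := left_kernel_vector
  (\matrix_(i < k, j < r) (ip (o j) (p i).1 +i* ip (o j) (p i).2)) rk.
case/eqP: c0; apply/rowP => i; rewrite mxE.
apply: (Ffree (fun i => c 0 i)) => e; apply: aeW => x; rewrite /= in_itv/= => xl.
rewrite /lin_comb (eq_bigr (fun i => \sum_j c 0 i *
  ((ip (o j) (p i).1 +i* ip (o j) (p i).2) * (o j e x)%:C))); last first.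
  move=> j _; rewrite -mulr_sumr -complex_sum; congr (_ * _).
  by case: (pP j) => _ _ ->; rewrite -!span.
rewrite exchange_big big1// => j _.
have /matrixP/(_ 0 j) := cA; rewrite !mxE => h.
transitivity ((0 : R[i]) * (o j e x)%:C); last by rewrite mul0r.
rewrite -[X in _ = X * _]h mulr_suml.
by apply: eq_bigr => i' _; rewrite mxE mulrA.
Qed.

Context (lam : nat -> R).
Hypothesis hlam : eigenvalue_sequence q (fun=> beta) lam.

Lemma orthonormal_eigenfunctions : exists f : nat -> gspace G,
  (forall i j, ip (f i) (f j) = (i == j)%:R) /\
  forall n, real_eigenfunction q beta (lam n) (f n).
Proof.
have /choice[H HP] : forall mu, exists h : nat -> gspace G, forall n, lam n = mu ->
    real_eigenfunction q beta mu (h n) /\ forall m, lam m = mu -> ip (h n) (h m) = (n == m)%:R.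
  move=> mu; have [_ /(_ mu)[k dk ck]] := hlam.
  have [+ [+ +]] := eigenspace_orthonormal dk; move=> o oo oe.
  have /pcard_eqP[phi] := ck.
  have phik n : lam n = mu -> (phi n < k)%N by move=> nmu; exact: (@funS _ _ _ _ phi n nmu).
  (* The default 0 is met only where [lam n] differs from [mu]. *)
  exists (fun n => oapp o 0 (insub (phi n))) => n nmu.
  rewrite (insubT (fun i => i < k)%N (phik _ nmu))/=; split=> [|m mmu]; first exact: oe.
  have key (a c : 'I_k) : nat_of_ord a = phi n -> nat_of_ord c = phi m -> (a == c) = (n == m).
    move=> an cm; apply/eqP/eqP => E; last by apply: val_inj; rewrite /= an cm E.
    apply: (@inj _ _ _ phi); rewrite ?inE//.
    exact: (etrans (esym an) (etrans (congr1 (@nat_of_ord k) E) cm)).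
  rewrite (insubT (fun i => i < k)%N (phik _ mmu))/= oo.
  exact: (congr1 (fun t : bool => t%:R)
    (key (Ordinal (phik _ nmu)) (Ordinal (phik _ mmu)) erefl erefl)).
exists (fun n => H (lam n) n); split=> [i j|n]; last by have [] := HP (lam n) n erefl.
have [ij|ij] := eqVneq (lam i) (lam j).
  by rewrite ij; have [_ ->] := HP (lam j) i ij.
have -> : (i == j) = false by apply: contraNF ij => /eqP ->.
apply: (eigenvalue_orthogonal bq b0 _ _ ij).
  by have [] := HP (lam i) i erefl.
by have [] := HP (lam j) j erefl.
Qed.

(** A pigeonhole argument: if [mu n < lam n], then [mu 0], ..., [mu n] are, with multiplicity,
    eigenvalues that the sequence [lam] can list only at indices below [n], that is, [n.+1] of them
    in [n] places. *)
Lemma eigenvalue_le (mu : nat -> R) (g : nat -> gspace G) n :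
  {homo mu : i j / (i <= j)%N >-> i <= j} ->
  (forall i j, ip (g i) (g j) = (i == j)%:R) ->
  (forall k, real_eigenfunction q beta (mu k) (g k)) ->
  lam n <= mu n.
Proof.
move=> mono gg ge; rewrite leNgt; apply/negP => lt_mu.
have [lmono ldim] := hlam.
have count_le (nu : R) : nu <= mu n ->
    (#|[pred j : 'I_n.+1 | mu j == nu]| <= #|[pred m : 'I_n | lam m == nu]|)%N.
  move=> nun; have [k dk ck] := ldim nu.
  apply: (@leq_trans k).
    pose o (j : 'I_#|[pred j : 'I_n.+1 | mu j == nu]|) := g (enum_val j).
    have oo : orthonormal_family (@ip R G) o.
      by move=> i j; rewrite /o gg (inj_eq val_inj) (inj_eq enum_val_inj).
    apply: (has_dim_independent (E := fun j e x => (o j e x)%:C) dk).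
      move=> j; apply: real_eigenfunction_complex => //.
      by have /eqP <- : mu (enum_val j) == nu by have := enum_valP j; rewrite inE.
    by move=> c; exact: orthonormal_independent.
  have /pcard_eqP[phi] := card_esym ck.
  have lamphi i : (i < k)%N -> lam (phi i) = nu by move=> ik; exact: (@funS _ _ _ _ phi i ik).
  have phin i : (i < k)%N -> (phi i < n)%N.
    move=> ik; rewrite ltnNge; apply/negP => /lmono; rewrite (lamphi _ ik) => h.
    by have := le_lt_trans (le_trans h nun) lt_mu; rewrite ltxx.
  pose psi (i : 'I_k) : 'I_n := Ordinal (phin i (ltn_ord i)).
  have psi_inj : injective psi.
    move=> i j [E]; apply: val_inj; apply: (@inj _ _ _ phi) => //; rewrite inE; exact: ltn_ord.
  rewrite -[X in (X <= _)%N](card_ord k) -(card_imset _ psi_inj).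
  apply: subset_leq_card; apply/fintype.subsetP => _ /imsetP[i _ ->].
  by rewrite inE/= lamphi.
(* Multiplicities are compared value by value, then added over the distinct values of [mu 0], ...,
   [mu n]. *)
pose s := undup [seq mu j | j : 'I_n.+1].
have sum_count (m : nat) (f : 'I_m -> R) :
    (\sum_(nu <- s) #|[pred j | f j == nu]| = #|[pred j | f j \in s]|)%N.
  rewrite -sum1_card [RHS]big_mkcond/=.
  under eq_bigr do rewrite -sum1_card big_mkcond/=.
  rewrite exchange_big/=; apply: eq_bigr => j _.
  rewrite inE; have -> : (if f j \in s then 1 else 0)%N = count_mem (f j) s.
    by rewrite count_uniq_mem ?undup_uniq//; case: ifP.
  rewrite -sum1_count [RHS]big_mkcond/=.
  by apply: eq_bigr => nu _; rewrite inE eq_sym.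
have : (n.+1 <= n)%N; last by rewrite ltnn.
have <- : (\sum_(nu <- s) #|[pred j : 'I_n.+1 | mu j == nu]| = n.+1)%N.
  rewrite sum_count -[RHS](card_ord n.+1); apply: eq_card => j.
  by rewrite !inE mem_undup map_f// mem_enum.
apply: (@leq_trans (\sum_(nu <- s) #|[pred m : 'I_n | lam m == nu]|)%N).
  rewrite [X in (X <= _)%N]big_seq [X in (_ <= X)%N]big_seq; apply: leq_sum => nu.
  rewrite mem_undup => /mapP[j _ ->]; apply: count_le; apply: mono.
  by rewrite -ltnS.
by rewrite sum_count (leq_trans (max_card _)) ?card_ord.
Qed.

End dimension.

(** * Comparison of eigenvalue means *)

Section comparison.
Context (R : realType) (G : metric_graph R).

(** A single vertex without edges is a connected graph. There [eq_L2] always holds, so no nonempty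
    family is independent and nothing could be listed as [lam 0]. *)
Lemma eigenvalue_sequence_edge (q : edge G -> R -> R) (beta : R) (lam : nat -> R) :
  eigenvalue_sequence q (fun=> beta) lam -> exists e : edge G, True.
Proof.
move=> [_ /(_ (lam 0%N))[k [F [_ Ffree _]] /pcard_eqP[phi]]].
apply: contrapT => noe.
have k0 : (phi 0%N < k)%N by exact: (@funS _ _ _ _ phi 0%N erefl).
have z : eq_L2 (lin_comb (fun=> 1) F) (fun _ _ => 0).
  by move=> e; exfalso; apply: noe; exists e.
by have /eqP := Ffree _ z (Ordinal k0); rewrite oner_eq0.
Qed.

(** The eigenfunctions of the anti-Kirchhoff operator are trial functions for the other form. The
    two potentials are independent, so that all four limits of the theorem are instances. *)
Lemma eigenvalue_sum_gap (qA qB : edge G -> R -> R) (beta : R) (lamA lamB : nat -> R) :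
  bounded_potential qA -> bounded_potential qB -> 0 < beta ->
  eigenvalue_sequence qA (fun=> 0) lamA -> eigenvalue_sequence qB (fun=> beta) lamB ->
  forall x : R, exists N0, forall N, (N0 <= N)%N ->
    x * N%:R <= \sum_(n < N) (lamA n - lamB n).
Proof.
move=> bA bB b0 hA hB x.
have [e0 _] := eigenvalue_sequence_edge hA.
have [mu [g [gsys ge]]] := eigensystem_exists e0 bB b0.
have [f [ff fe]] := orthonormal_eigenfunctions bA (lexx 0) hA.
have [MA _ qMA] := potential_bound bA; have [MB _ qMB] := potential_bound bB.
(* The extra [MB + MA] pays for replacing the potential [qB] by [qA] in the energies. *)
have [N0 hN0] := delta_trace_gap e0 bB b0 gsys (x + (MB + MA)).
exists N0 => N N0N; have H := hN0 N (fun n => f n) N0N.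
have [mono gg _ _] := gsys.
have fS n v : vertex_sum v (f n) = 0 by exact: eigenfunction_vertex_sum0 (fe n).
have {}H := H (fun i j => ff i j) (fun n => fS n).
have hBle : \sum_(n < N) lamB n <= \sum_(n < N) mu n.
  by apply: ler_sum => n _; exact: (eigenvalue_le bB hB n mono gg ge).
have hAge : \sum_(n < N) energy qB (f n) (f n) <= \sum_(n < N) lamA n + (MB + MA) * N%:R.
  have -> : (MB + MA) * N%:R = \sum_(n < N) (MB + MA) by rewrite sumr_const card_ord mulr_natr.
  rewrite -big_split/=; apply: ler_sum => n _.
  apply: le_trans (energy_le (f n) bB bA qMB qMA) _.
  by rewrite (eigenfunction_anti_kirchhoff bA (fe n) (fS n)) ff eqxx !mulr1.
rewrite sumrB; move: H; rewrite mulrDl; lra.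
Qed.

Lemma mean_diff_cvgy (lamA lamB : nat -> R) :
  (forall x : R, exists N0, forall N, (N0 <= N)%N ->
    x * N%:R <= \sum_(n < N) (lamA n - lamB n)) ->
  mean_diff lamA lamB @ \oo --> +oo.
Proof.
move=> H; apply/cvgryPge => x; have [N0 hN] := H x.
(* The successor ensures [N > 0], so that division by [N] is legitimate. *)
exists N0.+1 => // N /= N0N; rewrite /mean_diff.
have N1 : (0 : R) < N%:R by rewrite ltr0n (leq_ltn_trans _ N0N).
by rewrite mulrC ler_pdivlMr// hN// ltnW.
Qed.

Lemma mean_diff_cvgNy (lamA lamB : nat -> R) :
  (forall x : R, exists N0, forall N, (N0 <= N)%N ->
    x * N%:R <= \sum_(n < N) (lamA n - lamB n)) ->
  mean_diff lamB lamA @ \oo --> -oo.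
Proof.
move=> H; apply/cvgrNyPle => x; have [N0 hN] := H (- x).
exists N0.+1 => // N /= N0N; rewrite /mean_diff.
have N1 : (0 : R) < N%:R by rewrite ltr0n (leq_ltn_trans _ N0N).
rewrite mulrC ler_pdivrMr// -lerN2 -mulNr -sumrN.
under eq_bigr do rewrite opprB.
by apply: hN; exact: ltnW.
Qed.

End comparison.

Theorem theorem7 (R : realType) (G : metric_graph R)
    (hG : connected_graph G)
    (q : edge G -> R -> R) (hq : smooth_bounded_potential q)
    (beta beta' : R) (hbeta : 0 <= beta) (hbeta' : 0 <= beta')
    (hpos : 0 < beta + beta') (hzero : beta = 0 \/ beta' = 0)
    (lamq lamq' lam0' : nat -> R)
    (hlamq : eigenvalue_sequence q (fun=> beta) lamq)
    (hlamq' : eigenvalue_sequence q (fun=> beta') lamq')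
    (hlam0' : @eigenvalue_sequence R G (fun _ _ => 0) (fun=> beta') lam0') :
  (beta = 0 ->
     (mean_diff lamq lamq' @ \oo --> +oo) /\
     (mean_diff lamq lam0' @ \oo --> +oo)) /\
  (beta' = 0 ->
     (mean_diff lamq lamq' @ \oo --> -oo) /\
     (mean_diff lamq lam0' @ \oo --> -oo)).
Proof.
have bq := smooth_bounded_bcont hq.
have b0 : bounded_potential (fun (_ : edge G) (_ : R) => 0 : R) by move=> e; exact: bcont_cst.
split=> beta0; move: hpos; rewrite beta0 ?add0r ?addr0 => beta_gt0.
  rewrite beta0 in hlamq; split; apply: mean_diff_cvgy.
    exact: (eigenvalue_sum_gap bq bq beta_gt0 hlamq hlamq').
  exact: (eigenvalue_sum_gap bq b0 beta_gt0 hlamq hlam0').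
rewrite beta0 in hlamq' hlam0'.
(* The anti-Kirchhoff operator is now the subtracted one, which exchanges the roles and the sign; in
   the second limit it is the one with zero potential. *)
split; apply: mean_diff_cvgNy.
  exact: (eigenvalue_sum_gap bq bq beta_gt0 hlamq' hlamq).
exact: (eigenvalue_sum_gap b0 bq beta_gt0 hlam0' hlamq).
Qed.
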